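(* Let $\delta > 0$. There exist constants $c_0 = c_0(\delta) > 0$, $N_0 = N_0(\delta) > 0$ and $s_0 = s_0(\delta) > 0$, depending only on $\delta$, such that $$\mathbf{P}\{G_{\mathbf{v}} \le \gamma_{\mathbf{v}} - s\|\mathbf{v}\|^{1/3}\} \le \exp\{-c_0s^{3/2}\}$$ for all $\mathbf{v} \in S_\delta \cap \mathbb{Z}_{\ge N_0}^2$ and all real $s \ge s_0$.
   Context: Exponential last-passage percolation (LPP): $\{\omega_{\mathbf{v}}: \mathbf{v} \in \mathbb{Z}_{>0}^2\}$ are i.i.d. $\mathrm{Exp}(1)$ random variables ($\mathrm{Exp}(\lambda)$ is the exponential distribution with rate $\lambda$). For $\mathbf{u}\le\mathbf{v}$ (coordinatewise order), $\Pi_{\mathbf{u},\mathbf{v}}$ is the set of nearest-neighbor up-right lattice paths from $\mathbf{u}$ to $\mathbf{v}$ with steps $(1,0)$ and $(0,1)$, viewed as vertex sets including both endpoints. The last-passage time is $G_{\mathbf{v}} = \max_{\pi \in \Pi_{(1,1),\mathbf{v}}} \sum_{\mathbf{p}\in\pi}\omega_{\mathbf{p}}$ for $\mathbf{v}\in\mathbb{Z}_{>0}^2$. The shape function is $\gamma_{\mathbf{x}} = (\sqrt{x}+\sqrt{y})^2$ for $\mathbf{x}=(x,y)\in\mathbb{R}_{>0}^2$. $\|\cdot\|$ is the $L^1$ norm on $\mathbb{R}^2$. $S_\delta = \{(x,y)\in\mathbb{R}_{>0}^2: x\ge \delta y \text{ and } y\ge\delta x\}$, and $\mathbb{Z}_{\ge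 N}=\{n\in\mathbb{Z}: n\ge N\}$. *)

(* Defs.v *)
From HB Require Import structures.
From mathcomp Require Import all_boot all_order all_algebra finmap.
From mathcomp Require Import all_classical all_reals all_analysis.

Set Implicit Arguments.
Unset Strict Implicit.
Unset Printing Implicit Defensive.

Import Order.TTheory GRing.Theory Num.Theory.
Import numFieldNormedType.Exports.

Local Open Scope classical_set_scope.
Local Open Scope ring_scope.

(* Lattice points are pairs of naturals; the weights live on [pos_quadrant]
   only, nothing is assumed on the values of a field at sites off it. *)
Definition site : Type := (nat * nat)%type.

Definition pos_quadrant : set site := [set v | (0 < v.1)%N /\ (0 < v.2)%N].

Definition quadrant_from (N : nat) : set site :=
  [set v | (N <= v.1)%N /\ (N <= v.2)%N].

Section Plane.
Variable R : realType.

Definition site_point (v : site) : R * R := (v.1%:R, v.2%:R).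

(* The library norm on [R * R] is the maximum norm. *)
Definition l1norm (x : R * R) : R := `|x.1| + `|x.2|.

Definition lpp_shape (x : R * R) : R := (Num.sqrt x.1 + Num.sqrt x.2) ^+ 2.

Definition cone (delta : R) : set (R * R) :=
  [set x | [/\ 0 < x.1, 0 < x.2, delta * x.2 <= x.1 & delta * x.1 <= x.2]].

End Plane.

Definition up_right_step (u v : site) : bool :=
  (v == (u.1.+1, u.2)) || (v == (u.1, u.2.+1)).

(* An up-right path is recorded through its set of vertices. *)
Definition up_right_paths (u v : site) : set {fset site} :=
  [set [fset p in u :: s]%fset | s in
    [set s : seq site | path up_right_step u s /\ last u s = v]].

(* The set of path weights is finite, and nonempty when [u <= v], so [sup] is
   then a maximum: see [lpt_ub] and [lpt_attained]. *)
Definition lpt (R : realType) (w : site -> R) (u v : site) : R :=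
  sup [set \sum_(p <- enum_fset pi) w p | pi in up_right_paths u v].

Section LastPassageTime.

Lemma up_right_path_le (u v : site) (s : seq site) :
  path up_right_step u s -> last u s = v ->
  forall p, p \in u :: s -> (p.1 <= v.1)%N && (p.2 <= v.2)%N.
Proof.
elim: s u => [|a s IH] u /=.
  by move=> _ <- p; rewrite inE => /eqP ->; rewrite !leqnn.
move=> /andP[ua aP] lE p; rewrite inE => /orP[/eqP ->|]; last exact: IH.
have /andP[a1 a2] := IH a aP lE a (mem_head _ _).
apply/andP; move: ua; rewrite /up_right_step => /orP[]/eqP aE;
  move: a1 a2; rewrite aE /= => a1 a2; by rewrite ?(ltnW a1) ?(ltnW a2) ?a1 ?a2.
Qed.

Lemma finite_up_right_paths (u v : site) : finite_set (up_right_paths u v).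
Proof.
pose grid : {fset site} :=
  [fset p in [seq (i, j) | i <- iota 0 v.1.+1, j <- iota 0 v.2.+1]]%fset.
apply: (@sub_finite_set _ _ [set` fpowerset grid]); last exact: finite_fset.
move=> _ [s [sP sE] <-] /=; rewrite fpowersetE; apply/fsubsetP => p.
rewrite in_fset => /(up_right_path_le sP sE)/andP[p1 p2].
rewrite in_fset; apply/allpairsP; exists p.
by rewrite !mem_iota !add0n !ltnS p1 p2; case: (p).
Qed.

Lemma up_right_paths_nonempty (u v : site) :
  (u.1 <= v.1)%N -> (u.2 <= v.2)%N -> up_right_paths u v !=set0.
Proof.
move=> u1 u2; suff [s sP] : exists s, path up_right_step u s /\ last u s = v.
  by eexists; exists s.
rewrite [v]surjective_pairing -(subnKC u1) -(subnKC u2).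
move: (v.1 - u.1)%N (v.2 - u.2)%N => m n {u1 u2}.
elim: m u => [|m IH] u; last first.
  have [s /= [sP sE]] := IH (u.1.+1, u.2).
  exists ((u.1.+1, u.2) :: s) => /=; rewrite sP sE /up_right_step eqxx.
  by rewrite addSnnS.
rewrite addn0; elim: n u => [|n IH] u.
  by exists [::]; rewrite addn0 -surjective_pairing.
have [s /= [sP sE]] := IH (u.1, u.2.+1).
exists ((u.1, u.2.+1) :: s) => /=; rewrite sP sE /up_right_step eqxx orbT.
by rewrite addSnnS.
Qed.

Variable R : realType.

Lemma finite_set_max (S : set R) : finite_set S -> S !=set0 ->
  exists2 x, S x & ubound S x.
Proof.
case/finite_fsetP=> X ->; case=> x0 /= x0X.
have [x _ xP] := @arg_maxP _ _ X [` x0X]%fset predT val isT.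
exists (val x); first exact: valP.
by move=> y /= yX; exact: (xP [` yX]%fset).
Qed.

Variables (w : site -> R) (u v : site).

Let weights := [set \sum_(p <- enum_fset pi) w p | pi in up_right_paths u v].

Let finite_weights : finite_set weights.
Proof. exact/finite_image/finite_up_right_paths. Qed.

Lemma lpt_ub pi : up_right_paths u v pi ->
  \sum_(p <- enum_fset pi) w p <= lpt w u v.
Proof.
move=> piP; have W : weights (\sum_(p <- enum_fset pi) w p) by exists pi.
have [x _ xub] := finite_set_max finite_weights (ex_intro _ _ W).
by apply: ub_le_sup => //; exists x.
Qed.

Lemma lpt_attained : (u.1 <= v.1)%N -> (u.2 <= v.2)%N ->
  exists2 pi, up_right_paths u v pi & lpt w u v = \sum_(p <- enum_fset pi) w p.
Proof.
move=> /up_right_paths_nonempty/[apply] -[pi0 pi0P].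
have W : weights !=set0 by eexists; exists pi0.
have [_ [pi piP <-] piub] := finite_set_max finite_weights W.
by exists pi => //; apply/le_anti; rewrite lpt_ub// andbT; exact: ge_sup.
Qed.

End LastPassageTime.

Section Independence.
Context {d : measure_display} {T : measurableType d} {R : realType}.
Variable P : probability T R.

Definition mutually_independent (I : choiceType) (D : set I)
    (X : I -> {RV P >-> R}) : Prop :=
  forall J : {fset I}, [set` J] `<=` D ->
  forall A : I -> set R, (forall i, measurable (A i)) ->
  P (\bigcap_(i in [set` J]) (X i @^-1` A i)) =
  (\prod_(i <- enum_fset J) P (X i @^-1` A i))%E.

Definition iid_exp1 (X : site -> {RV P >-> R}) : Prop :=
  mutually_independent pos_quadrant X /\
  forall v, pos_quadrant v -> forall A : set R, measurable A ->
    distribution P (X v) A = exponential_prob 1 A.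

End Independence.

(* Main.v *)
Require Import Defs.
From HB Require Import structures.
From mathcomp Require Import all_boot all_order all_algebra finmap.
From mathcomp Require Import all_classical all_reals all_analysis.
From mathcomp Require Import measurable_realfun ring lra.

(** Let v = (m, n), let g be the value of the shape function at v and
    zeta = sqrt m / (sqrt m + sqrt n). The proof adds exponential weights along two
    sides of the rectangle, of rate w on a horizontal side and 1 - z on a vertical
    one, and transfers a lower tail from such a model to the bulk.

    Moment identity. For w = z the model is stationary: passing a cell preserves
    the joint law of the increments around it ([burke_cell]). The general case is
    reduced to this one by tilting the weights of the horizontal side from rate w
    to rate z, which gives ([lastpass_mgf])
      E exp ((w - z) G) = (w / z)^m ((1 - z) / (1 - w))^n = exp (f w - f z),
    with f u = m ln u - n ln (1 - u). By [slope_eq],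
      f' u = m / u + n / (1 - u) = g + g (u - zeta)^2 / (u (1 - u)),
    so that parameters at distance eps from zeta control deviations of order
    g eps^2 with probability exp (- c g eps^3): an upper tail if z < w and a lower
    tail if w < z. A deviation s (m + n)^(1/3) corresponds to eps of order
    sqrt s (m + n)^(-1/3), and g eps^3 is then of order s^(3/2).

    Removal of the boundary. Let L (i, j) be the passage time from (1, 1) to (i, j)
    in the bulk, and U the passage time with additional weights of rates zeta - eps
    and 1 - zeta - eps on the north and east sides. The identity bounds the lower
    tail of U. The optimal path of U leaves the bulk at some (k, n), say, and two
    cases arise ([top_exit_bound]). If m - k is much larger than g eps, the boundary
    weights could be improved to rate zeta - 2 eps with a gain above a large
    multiple of g eps^2, which the upper tail of the improved model makes unlikely. Otherwise
    L (m, n) - L (k, n) is compared with the increments of a stationary model of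
    parameter zeta + 2 eps with boundaries on the south and west sides: by
    monotonicity of the increments in the boundary weights ([bulk_increment_ge])
    the bulk increments are larger, on the likely event that the west boundary
    prevails. What remains is the supremum over k of a random walk, namely sums of
    boundary weights minus sums of stationary increments. It is bounded by the
    waiting time of a stationary queue, realized as a vertical increment in one more
    stationary row placed on top of the rectangle, hence of explicit exponential law
    ([near_exit], [stack_vinc_tail]).
    So U <= L (m, n) + C g eps^2 with the required probability
    ([lastpass_bulk_lower_tail]).

    All boundary weights are weights of the given field at other sites, rescaled
    ([spread]), so the whole argument takes place on the given probability space. *)

Set Implicit Arguments.
Unset Strict Implicit.
Unset Printing Implicit Defensive.

Import Order.TTheory GRing.Theory Num.Theory.
Import numFieldNormedType.Exports.

Local Open Scope classical_set_scope.
Local Open Scope ring_scope.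

(** * Independent families *)

Section HalfLines.
Context {R : realType}.

Lemma eq_measure_half_lines (m1 m2 : {measure set R -> \bar R}) :
  (m1 setT < +oo)%E ->
  (forall r, m1 `]r, +oo[%classic = m2 `]r, +oo[%classic) ->
  forall A, measurable A -> m1 A = m2 A.
Proof.
move=> m1oo m12.
apply: (measure_unique (@measurable_realfun.RGenOInfty.G R) (fun n => `]- n%:R, +oo[%classic)).
- exact: measurable_realfun.RGenOInfty.measurableE.
- move=> _ _ [x ->] [y ->]; exists (Num.max x y).
  by apply/seteqP; split=> z /=; rewrite !in_itv /= !andbT gt_max => /andP.
- by move=> n; exists (- n%:R).
- rewrite -subTset => x _; exists (Num.truncn `|x|).+1 => //=.
  rewrite in_itv /= andbT ltrNl; apply: le_lt_trans (truncnS_gt _).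
  by rewrite -normrN ler_norm.
- by move=> _ [r ->].
- move=> n; apply: le_lt_trans m1oo; apply: le_measure; rewrite ?inE//.
Qed.

End HalfLines.

Section IndependentFamilies.
Context {d : measure_display} {T : measurableType d} {R : realType}.

(** Joint law of a family indexed by an arbitrary set, as the product rule over
    finite lists of indices. The marginals are plain set functions, which only
    matter on measurable sets: this lets an update of the family change some
    marginals without building a new measure. *)
Definition indep_law (P : probability T R) (K : eqType) (X : K -> T -> R)
    (mu : K -> set R -> \bar R) : Prop :=
  (forall k, measurable_fun setT (X k)) /\
  forall (s : seq K) (A : K -> set R), uniq s -> (forall k, measurable (A k)) ->
    P [set t | forall k, k \in s -> A k (X k t)] = (\prod_(k <- s) mu k (A k))%E.

Lemma measurable_preimage_fun (f : R -> R) (A : set R) :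
  measurable_fun setT f -> measurable A -> measurable (f @^-1` A).
Proof. by move=> mf mA; rewrite -[X in measurable X]setTI; exact: mf. Qed.

Section Basic.
Variables (P : probability T R) (K : eqType).
Implicit Types (X : K -> T -> R) (mu : K -> set R -> \bar R).

Lemma measurable_preimageT (f : T -> R) (A : set R) :
  measurable_fun setT f -> measurable A -> measurable (f @^-1` A).
Proof. by move=> mf mA; rewrite -[X in measurable X]setTI; exact: mf. Qed.

Lemma measurable_event X (s : seq K) (A : K -> set R) :
  (forall k, measurable_fun setT (X k)) -> (forall k, measurable (A k)) ->
  measurable [set t | forall k, k \in s -> A k (X k t)].
Proof.
move=> mX mA; elim: s => [|a s IH].
  by rewrite (_ : [set _ | _] = setT)//; apply/seteqP; split.
rewrite (_ : [set _ | _] = (X a @^-1` A a) `&`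
   [set t | forall k, k \in s -> A k (X k t)]); last first.
  apply/seteqP; split => t /= => [H|[Ha Hs] k].
    by split; [apply: H; rewrite mem_head|move=> k ks; apply: H; rewrite inE ks orbT].
  by rewrite inE => /orP[/eqP->//|]; exact: Hs.
by apply: measurableI => //; exact: measurable_preimageT.
Qed.

Lemma indep_law_marginal X mu k A : indep_law P X mu -> measurable A ->
  P (X k @^-1` A) = mu k A.
Proof.
move=> [mX PX] mA; have := PX [:: k] (fun=> A) isT (fun=> mA).
rewrite big_seq1 => <-; congr (P _); apply/seteqP; split => t /=.
  by move=> At k'; rewrite inE => /eqP ->.
by apply; rewrite inE.
Qed.

Lemma indep_law_setT X mu k : indep_law P X mu -> mu k setT = 1%E.
Proof. by move=> /indep_law_marginal <-//; rewrite preimage_setT probability_setT. Qed.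

Lemma indep_law_eq X mu mu' : (forall k A, measurable A -> mu k A = mu' k A) ->
  indep_law P X mu -> indep_law P X mu'.
Proof.
move=> e [mX PX]; split=> // s A us mA; rewrite PX//.
by apply: eq_bigr => k _; exact: e.
Qed.

Lemma indep_law_reindex (K' : eqType) (phi : K' -> K) X mu : injective phi ->
  indep_law P X mu -> indep_law P (fun k => X (phi k)) (fun k => mu (phi k)).
Proof.
move=> phiI [mX PX]; split=> [k|s A us mA]; first exact: mX.
pose B k := \bigcap_(i in [set i | i \in s /\ phi i = k]) A i.
have BE i : i \in s -> B (phi i) = A i.
  move=> is_; apply/seteqP; split => x; first by move=> /(_ i); apply.
  by move=> Aix j [js /phiI ->].
have mB k : measurable (B k).
  have [[i [is_ <-]]|nk] := pselect (exists i, i \in s /\ phi i = k).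
    by rewrite BE.
  rewrite (_ : B k = setT)//; apply/seteqP; split => // x _ i [is_ ik].
  by case: nk; exists i.
have := PX (map phi s) B; rewrite map_inj_uniq// => /(_ us mB).
rewrite big_map => E; transitivity (\prod_(k <- s) mu (phi k) (B (phi k)))%E.
  rewrite -E; congr (P _); apply/seteqP; split => t /= H k.
    by case/mapP => i is_ ->; rewrite BE//; exact: H.
  by move=> ks; rewrite -(BE k ks); apply: H; exact: map_f.
by rewrite big_seq [RHS]big_seq; apply: eq_bigr => k /BE ->.
Qed.

Lemma indep_law_comp (f : K -> R -> R) X mu :
  (forall k, measurable_fun setT (f k)) -> indep_law P X mu ->
  indep_law P (fun k t => f k (X k t)) (fun k A => mu k (f k @^-1` A)).
Proof.
move=> mf [mX PX]; split=> [k|s A us mA]; first exact: (measurableT_comp (mf k) (mX k)).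
by apply: PX => // k; exact: measurable_preimage_fun.
Qed.

End Basic.

Section Pair.
Variables (P : probability T R) (K : eqType).
Variables (X : K -> T -> R) (mu : K -> set R -> \bar R) (i j : K).
Hypotheses (indX : indep_law P X mu) (ij : i != j).

Let mX k : measurable_fun setT (X k). Proof. exact: indX.1. Qed.

(** Both sides are measures in D that agree on rectangles, after conditioning on
    the constraints on the other indices. It is the source of every pairwise
    update of a family. *)
Lemma indep_law_pair (s : seq K) (A : K -> set R) (D : set (R * R)) :
  uniq [:: i, j & s] -> (forall k, measurable (A k)) -> measurable D ->
  P ([set t | D (X i t, X j t)] `&` [set t | forall k, k \in s -> A k (X k t)]) =
  ((pushforward P (X i) \x pushforward P (X j)) D * \prod_(k <- s) mu k (A k))%E.
Proof.
move=> us mA mD; set C := [set t | forall k, _].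
have mC : measurable C by exact: measurable_event.
have us' : uniq s by case/and3P: us.
have PC : P C = (\prod_(k <- s) mu k (A k))%E by exact: indX.2.
rewrite -PC.
pose Xi : {RV P >-> R} := HB.pack (X i) (isMeasurableFun.Build _ _ _ _ _ (mX i)).
pose Xj : {RV P >-> R} := HB.pack (X j) (isMeasurableFun.Build _ _ _ _ _ (mX j)).
have mXX : measurable_fun setT (fun t => (X i t, X j t)).
  by apply/measurable_fun_pair => /=; exact: mX.
have rect U V : measurable U -> measurable V ->
    P ([set t | (U `*` V) (X i t, X j t)] `&` C) = (mu i U * mu j V * P C)%E.
  move=> mU mV; pose B k := if k == i then U else if k == j then V else A k.
  have mB k : measurable (B k) by rewrite /B; do 2 case: ifP => // _.
  have ji : (j == i) = false by rewrite eq_sym (negbTE ij).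
  have := indX.2 [:: i, j & s] B us mB; rewrite !big_cons.
  rewrite {2 3}/B eqxx ji eqxx muleA PC => E.
  rewrite (_ : \prod_(k <- s) mu k (A k) = \prod_(k <- s) mu k (B k))%E; last first.
    rewrite big_seq [RHS]big_seq; apply: eq_bigr => k ks; rewrite /B.
    move: us => /and3P[]; rewrite inE negb_or => /andP[_ nis] njs _.
    rewrite ifF; last by apply/negbTE; apply: contraNneq nis => <-.
    by rewrite ifF//; apply/negbTE; apply: contraNneq njs => <-.
  rewrite -E; congr (P _); apply/seteqP; split => t /=.
    move=> [[Ut Vt] Ct] k; rewrite !inE /B; case: eqP => [->//|_] /=.
    by case: eqP => [->//|_] /=; exact: Ct.
  move=> H; split; first split.
  - by have := H i; rewrite !inE /B !eqxx /=; apply.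
  - by have := H j; rewrite !inE /B ji !eqxx /=; apply.
  - move=> k ks; have := H k; rewrite !inE ks !orbT => /(_ isT); rewrite /B.
    move: us => /and3P[]; rewrite inE negb_or => /andP[_ nis] njs _.
    rewrite ifF; last by apply/negbTE; apply: contraNneq nis => <-.
    by rewrite ifF//; apply/negbTE; apply: contraNneq njs => <-.
have [PC0|PC0] := eqVneq (P C) 0%E.
  rewrite PC0 mule0; apply/eqP; rewrite eq_le measure_ge0 andbT -PC0.
  apply: le_measure; rewrite ?inE//.
  apply: measurableI => //; have := (mXX) measurableT D mD; by rewrite setTI.
have PCfin : P C \is a fin_num by exact: fin_num_measure.
pose c := fine (P C).
have c0 : 0 < c by rewrite fine_gt0// lt0e PC0 measure_ge0 /= ltey_eq PCfin.
have cE : P C = c%:E by rewrite fineK.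
have cinv : 0 <= c^-1 by rewrite invr_ge0 ltW.
pose m' := mscale (NngNum cinv) 
  (pushforward (mrestr P mC) (fun t => (X i t, X j t))).
have := @product_measure_unique _ _ _ _ R (distribution P Xi) (distribution P Xj)
  (m' mXX).
move=> /(_ _ D mD); rewrite /distribution => ->.
  rewrite /m' /mscale /pushforward /mrestr /= cE muleAC -EFinM mulVf ?gt_eqF// mul1e.
  by [].
move=> U V mU mV; transitivity (c^-1%:E * (mu i U * mu j V * P C))%E.
  by rewrite -(rect U V mU mV).
rewrite cE muleCA -EFinM mulVf ?gt_eqF// mule1.
by rewrite -(indep_law_marginal i indX mU) -(indep_law_marginal j indX mV).
Qed.

End Pair.

(** The indices that an update touches may be assumed to head the list of
    constraints: a missing one is added with the trivial constraint. *)
Lemma indep_law_ext (P : probability T R) (K : eqType) (u : seq K)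
    (Y : K -> T -> R) (nu : K -> set R -> \bar R) :
  (forall k, measurable_fun setT (Y k)) -> uniq u ->
  (forall k, k \in u -> nu k setT = 1%E) ->
  (forall (s : seq K) (A : K -> set R), uniq (u ++ s) ->
    (forall k, measurable (A k)) ->
    P [set t | forall k, k \in u ++ s -> A k (Y k t)] =
    (\prod_(k <- u ++ s) nu k (A k))%E) ->
  indep_law P Y nu.
Proof.
move=> mY uu nu1 PY; split=> // s A us mA.
pose B k := if k \in s then A k else setT.
have mB k : measurable (B k) by rewrite /B; case: ifP.
pose s' := [seq k <- s | k \notin u].
have us' : uniq (u ++ s').
  rewrite cat_uniq uu filter_uniq// andbT /=.
  by apply/hasPn => k; rewrite mem_filter => /andP[].
have sub k : k \in s -> k \in u ++ s'.
  by move=> ks; rewrite mem_cat mem_filter ks andbT orbN.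
transitivity (P [set t | forall k, k \in u ++ s' -> B k (Y k t)]).
  congr (P _); apply/seteqP; split => t /= H k ks.
    by rewrite /B; case: ifPn => // ks'; exact: H.
  by have := H k (sub k ks); rewrite /B ks.
rewrite PY// (eq_big_seq (fun k => if k \in s then nu k (A k) else 1%E)); last first.
  move=> k; rewrite /B; case: ifPn => // ks; rewrite mem_cat.
  by move=> /orP[/nu1//|]; rewrite mem_filter (negbTE ks) andbF.
rewrite -big_mkcond -big_filter; apply: perm_big.
apply: uniq_perm => //; first exact: filter_uniq.
by move=> k; rewrite mem_filter; case: (boolP (k \in s)) => //= /sub.
Qed.

End IndependentFamilies.

(** * Integration against a density *)

Section Density.
Local Open Scope ereal_scope.
Context {d : measure_display} {T : measurableType d} {R : realType}.
Variables (m nu : {measure set T -> \bar R}) (g : T -> R).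
Hypotheses (mg : measurable_fun setT g) (g0 : forall x, (0 <= g x)%R).
Hypothesis nuE : forall A, measurable A -> nu A = \int[m]_(x in A) (g x)%:E.

Import HBNNSimple.

Let integral_density_nnsfun (h : {nnsfun T >-> R}) :
  \int[nu]_x (h x)%:E = \int[m]_x ((h x)%:E * (g x)%:E).
Proof.
under [LHS]eq_integral do rewrite fimfunE -fsumEFin//.
rewrite [LHS]ge0_integral_fsum//; last 2 first.
  - by move=> r; exact/measurable_EFinP/measurableT_comp.
  - by move=> n x _; rewrite EFinM nnfun_muleindic_ge0.
under [RHS]eq_integral.
  move=> x xD; rewrite fimfunE -fsumEFin// ge0_mule_fsuml; last first.
    by move=> r; rewrite EFinM nnfun_muleindic_ge0.
  over.
rewrite [RHS]ge0_integral_fsum//; last 2 first.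
  - move=> r; apply: emeasurable_funM; last exact/measurable_EFinP.
    by apply/measurable_EFinP; do 2 apply/measurableT_comp => //.
  - move=> n x _; apply: mule_ge0; last by rewrite lee_fin.
    by rewrite EFinM nnfun_muleindic_ge0.
apply: eq_fsbigr => r _.
rewrite integralZl_indic_nnsfun//. rewrite (integral_indic nu measurableT (A := h @^-1` [set r]))// setIT.
have [r0|r0] := ltP r 0%R.
  rewrite preimage_nnfun0// measure0 mule0 integral0_eq// => x _.
  by rewrite indic0 mulr0 mul0e.
under [RHS]eq_integral do rewrite EFinM -muleA.
rewrite ge0_integralZl//; last 2 first.
  - apply: emeasurable_funM; last exact/measurable_EFinP.
    by apply/measurable_EFinP.
  - by move=> x _; rewrite mule_ge0// lee_fin.
congr (_ * _); rewrite nuE// [LHS]integral_mkcond/=; apply: eq_integral => x _.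
by rewrite patchE indicE; case: ifPn => _; rewrite ?mul1e ?mul0e.
Qed.

Lemma ge0_integral_density (f : T -> \bar R) : measurable_fun setT f ->
  (forall x, 0 <= f x) -> \int[nu]_x f x = \int[m]_x (f x * (g x)%:E).
Proof.
move=> mf f0; pose f_ := nnsfun_approx measurableT mf.
transitivity (limn (fun n => \int[nu]_x (f_ n x)%:E)).
  rewrite -monotone_convergence//=.
  - apply: eq_integral => x _; apply/esym/cvg_lim => //=.
    exact: cvg_nnsfun_approx.
  - by move=> n; apply: measurableT_comp => //; exact: measurable_funTS.
  - by move=> n x _; rewrite lee_fin.
  - by move=> x _ a b ab; rewrite lee_fin//; exact/lefP/nd_nnsfun_approx.
rewrite (_ : \int[m]_x _ =
    limn (fun n => \int[m]_x ((f_ n x)%:E * (g x)%:E))); last first.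
  rewrite -monotone_convergence//=.
  - apply: eq_integral => x _; apply/esym/cvg_lim => //.
    by apply: cvgeZr => //; exact: cvg_nnsfun_approx.
  - move=> n; apply: emeasurable_funM; last exact/measurable_EFinP.
    by apply/measurable_EFinP.
  - by move=> n x _; rewrite mule_ge0// lee_fin.
  - move=> x _ a b ab; apply: lee_wpmul2r; first by rewrite lee_fin.
    by rewrite lee_fin//; exact/lefP/nd_nnsfun_approx.
by congr (limn _); apply/funext => n /=; rewrite integral_density_nnsfun.
Qed.
End Density.

(** * Updates of families and exponential laws *)

Section Update.
Context {d : measure_display} {T : measurableType d} {R : realType}.
Variables (P : probability T R) (K : eqType).
Variables (X : K -> T -> R) (mu : K -> set R -> \bar R).
Hypothesis indX : indep_law P X mu.

Lemma indep_law_update2 (i j : K) (F1 F2 : R * R -> R) (mu1 mu2 : set R -> \bar R) :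
  i != j -> measurable_fun setT F1 -> measurable_fun setT F2 ->
  mu1 setT = 1%E -> mu2 setT = 1%E ->
  (forall A B, measurable A -> measurable B ->
    (pushforward P (X i) \x pushforward P (X j))%E
      [set z | A (F1 z) /\ B (F2 z)] = (mu1 A * mu2 B)%E) ->
  indep_law P
    (fun k => if k == i then (fun t => F1 (X i t, X j t))
              else if k == j then (fun t => F2 (X i t, X j t)) else X k)
    (fun k => if k == i then mu1 else if k == j then mu2 else mu k).
Proof.
move=> ij mF1 mF2 mu1T mu2T H.
have ji : (j == i) = false by rewrite eq_sym (negbTE ij).
have mX := indX.1.
have mXX : measurable_fun setT (fun t => (X i t, X j t)).
  by apply/measurable_fun_pair => /=; exact: mX.
apply: (@indep_law_ext _ _ _ _ _ [:: i; j]).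
- move=> k; case: eqP => _; first exact: (measurableT_comp mF1 mXX).
  case: eqP => _; [exact: (measurableT_comp mF2 mXX)|exact: mX].
- by rewrite /= inE ij.
- by move=> k; rewrite !inE => /orP[]/eqP ->; rewrite ?eqxx ?ji.
move=> s A us mA; rewrite !big_cons !eqxx ji.
have nij k : k \in s -> (k == i) = false /\ (k == j) = false.
  move=> ks; move: us => /= /and3P[]; rewrite inE negb_or => /andP[_ nis] njs _.
  split; apply/negbTE; first by apply: contraNneq nis => <-.
  by apply: contraNneq njs => <-.
pose D := [set z | A i (F1 z) /\ A j (F2 z)].
have mD : measurable D.
  rewrite (_ : D = (F1 @^-1` A i) `&` (F2 @^-1` A j))//.
  by apply: measurableI; rewrite -[X in measurable X]setTI; [exact: mF1|exact: mF2].
have := indep_law_pair indX ij us mA mD; rewrite H// -muleA => E.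
transitivity (P ([set t | D (X i t, X j t)] `&`
                 [set t | forall k, k \in s -> A k (X k t)])).
  congr (P _); apply/seteqP; split => t /=.
    move=> Ht; split; first split.
    - by have := Ht i; rewrite !inE !eqxx /=; apply.
    - by have := Ht j; rewrite !inE !eqxx ji orbT /=; apply.
    - move=> k ks; have := Ht k; have [-> ->] := nij _ ks.
      by rewrite !inE ks !orbT; apply.
  move=> [[A1 A2] As] k; rewrite !inE.
  case: eqP => [->//|_] /=; case: eqP => [->//|_] /=; exact: As.
rewrite E; congr (_ * (_ * _))%E.
by apply: eq_big_seq => k ks; have [-> ->] := nij _ ks.
Qed.

Lemma indep_law_swap (i l : K) : (forall A, measurable A -> mu i A = mu l A) ->
  indep_law P (fun k => if k == i then X l else if k == l then X i else X k) mu.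
Proof.
move=> il; pose tau k := if k == i then l else if k == l then i else k.
have tauK : involutive tau.
  move=> k; rewrite /tau; case: (eqVneq k i) => [->|ki].
    by rewrite eqxx; case: eqVneq => [->|].
  by case: (eqVneq k l) => [->|kl]; rewrite ?eqxx// (negbTE ki) (negbTE kl).
have := indep_law_reindex (can_inj tauK) indX.
move=> /(@indep_law_eq _ _ _ _ _ _ _ mu) H.
rewrite (_ : (fun k => _) = (fun k => X (tau k))).
  apply: H => k A mA; rewrite /tau; case: eqP => [->|_]; first by rewrite il.
  by case: eqP => [->|//]; rewrite il.
by apply/funext => k; rewrite /tau; case: eqP => // _; case: eqP.
Qed.

End Update.

Section Exponential.
Context {R : realType}.
Implicit Types (a b r : R).
Local Notation Exp a := (exponential_prob (a : R)).

Lemma Exp_half_line a r : 0 < a -> Exp a `]r, +oo[%classic = (expR (- a * Num.max r 0))%:E.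
Proof.
move=> a0; pose m : probability (measurableTypeR R) R := exponential_prob a.
have pos : forall x, 0 < x -> Exp a `]x, +oo[%classic = (expR (- a * x))%:E.
  move=> x x0; have E : `]x, +oo[%classic = ~` (`]-oo, 0[%classic `|` `[0, x]%classic).
    apply/seteqP; split => y /=; rewrite !in_itv /= !andbT.
      by move=> xy [|/andP[_]]; [rewrite ltNge (ltW (lt_trans x0 xy))|rewrite leNgt xy].
    move=> /not_orP[y0 yx]; rewrite ltNge; apply/negP => yx'; apply: yx.
    by rewrite yx' andbT leNgt; apply/negP.
  have m0 : m a0 (`]-oo, (0 : R)[%classic : set R) = 0%E.
    rewrite /m /= /exponential_prob integral0_eq// => y /=.
    by rewrite in_itv /= => y0; rewrite lt0_exponential_pdf.
  rewrite E -[LHS]/(m a0 _) probability_setC; last exact: measurableU.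
  rewrite measureU//; last first.
    by apply/seteqP; split => // y [] /=; rewrite !in_itv /= ltNge => /negbTE -> .
  rewrite [X in (_ - (X + _))%E]m0 add0e [X in (_ - X)%E]/= exponential_prob_itv0c//.
  by rewrite -!EFinB subKr.
have [r0|r0] := ltP 0 r; first by rewrite pos.
rewrite mulr0 expR0 -[LHS]/(m a0 _); apply/eqP; rewrite eq_le probability_le1//=.
rewrite leNgt; apply/negP => lt1.
have fin : m a0 (`]r, +oo[%classic : set R) \is a fin_num by exact: fin_num_measure.
set q := fine (m a0 (`]r, +oo[%classic : set R)); have qE : m a0 (`]r, +oo[%classic : set R) = q%:E by rewrite fineK.
rewrite qE lte_fin in lt1.
have q0 : 0 <= q by rewrite fine_ge0.
pose x : R := (1 - q) / (2 * a).
have x0 : 0 < x by rewrite divr_gt0 ?mulr_gt0// subr_gt0.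
have : (m a0 (`]x, +oo[%classic : set R) <= m a0 (`]r, +oo[%classic : set R))%E.
  apply: le_measure; rewrite ?inE// => y /=; rewrite !in_itv /= !andbT.
  by apply: le_lt_trans; rewrite (le_trans r0)// ltW.
rewrite qE [X in (X <= _)%E]pos// lee_fin => H.
have H2 := expR_ge1Dx (- a * x).
have E : - a * ((1 - q) / (2 * a)) = - (1 - q) / 2 by field; rewrite gt_eqF.
rewrite -/x in E; have := le_trans H2 H; rewrite E; lra.
Qed.

(** Equality on measurable sets, so that laws of random variables qualify. *)
Definition is_exp a (m : set R -> \bar R) :=
  forall A, measurable A -> m A = Exp a A.

(** Lack of memory: both sides are measures in A, which agree on half-lines. *)
Lemma is_exp_shift a (m : {measure set R -> \bar R}) r (A : set R) : 0 < a ->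
  is_exp a m -> 0 <= r -> measurable A ->
  m [set x | r < x /\ A (x - r)] = ((expR (- a * r))%:E * m A)%E.
Proof.
move=> a0 mE r0 mA.
have mshift : measurable_fun setT (fun x : R => x - r) by exact: measurable_funB.
have mr : measurable `]r, +oo[%classic by [].
pose m1 : {measure set R -> \bar R} := pushforward (mrestr m mr) (fun x : R => x - r).
have e0 : 0 <= expR (- a * r) by exact: expR_ge0.
pose m2 : {measure set R -> \bar R} := mscale (NngNum e0) m.
transitivity (m1 mshift A).
  congr (m _); apply/seteqP; split => x /=; rewrite /= in_itv /= andbT.
    by move=> [].
  by move=> [].
have mT : m setT = 1%E by rewrite mE//; exact: integral_exponential_pdf.
rewrite (@eq_measure_half_lines _ (m1 mshift) m2)//.
  apply: (@le_lt_trans _ _ (m setT)); last by rewrite mT ltry.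
  rewrite /m1 /= /pushforward /mrestr preimage_setT setTI.
  by apply: le_measure; rewrite ?inE.
move=> x; rewrite /m1 /m2 /= /pushforward /mrestr /mscale /=.
rewrite [in RHS]mE// Exp_half_line// -EFinM -expRD -mulrDr.
rewrite (_ : _ `&` _ = `](Num.max (x + r) r), +oo[%classic); last first.
  apply/seteqP; split => y /=; rewrite !in_itv /= !andbT gt_max ltrBrDr.
    by move=> [-> ->].
  by move=> /andP[].
rewrite mE// Exp_half_line//; congr (expR (_ * _))%:E.
by rewrite maxElt; case: ifPn; rewrite !maxElt; case: ifPn; case: ifPn; lra.
Qed.

End Exponential.

Lemma product_probabilityT {R : realType} (m1 m2 : probability R R) :
  (m1 \x m2)%E setT = 1%E.
Proof.
rewrite -setXTT product_measure1E// -[RHS]mule1.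
by congr (_ * _)%E; exact: probability_setT.
Qed.

(** * The Burke property of one cell *)

Section MinDiff.
Context {R : realType}.
Local Notation Exp a := (exponential_prob (a : R)).
Variables (a b : R) (m1 m2 : probability R R).
Hypotheses (a0 : 0 < a) (b0 : 0 < b) (m1E : is_exp a m1) (m2E : is_exp b m2).
Local Notation m12 := (m1 \x m2)%E.

(** Lack of memory in both coordinates; rectangles determine the measure. *)
Lemma is_exp_pair_shift r (D : set (R * R)) : 0 <= r -> measurable D ->
  m12 [set z | [/\ r < z.1, r < z.2 & D (z.1 - r, z.2 - r)]] =
  ((expR (- (a + b) * r))%:E * m12 D)%E.
Proof.
move=> r0 mD.
pose shift (z : R * R) := (z.1 - r, z.2 - r).
have mshift : measurable_fun setT shift.
  by apply/measurable_fun_pair => /=; exact: measurable_funB.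
pose Q : set (R * R) := `]r, +oo[%classic `*` `]r, +oo[%classic.
have mQ : measurable Q by exact: measurableX.
have e0 : 0 <= expR ((a + b) * r) by exact: expR_ge0.
pose m' : {measure set (R * R) -> \bar R} :=
  mscale (NngNum e0) (pushforward (mrestr m12 mQ) shift).
have QE (D' : set (R * R)) : shift @^-1` D' `&` Q =
    [set z | [/\ r < z.1, r < z.2 & D' (z.1 - r, z.2 - r)]].
  apply/seteqP; split => z; rewrite /Q /shift /= !in_itv /= !andbT.
    by move=> [? [? ?]]; split.
  by move=> [? ? ?]; split.
rewrite [in RHS](@product_measure_unique _ _ _ _ R m1 m2 (m' mshift))//.
  rewrite /m' /= /mscale /= /pushforward /mrestr QE muleA -EFinM -expRD.
  by rewrite mulNr addNr expR0 mul1e.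
move=> A B mA mB.
rewrite /m' /= /mscale /= /pushforward /mrestr QE.
rewrite (_ : [set z | _] =
  [set x | r < x /\ A (x - r)] `*` [set x | r < x /\ B (x - r)]); last first.
  by apply/seteqP; split => z /=; [case=> ? ? []|case=> -[? ?] []].
have mS (C : set R) : measurable C -> measurable [set x | r < x /\ C (x - r)].
  move=> mC; rewrite (_ : [set x | _] = `]r, +oo[%classic `&` (fun x => x - r) @^-1` C).
    apply: measurableI => //; rewrite -[X in measurable X]setTI.
    by apply: (measurable_funB (@measurable_id _ _ _) (@measurable_cst _ _ _ _ _ _)).
  by apply/seteqP; split => x /=; rewrite in_itv /= andbT.
rewrite [X in (_ * X)%E]product_measure1E//; [|exact: mS|exact: mS].
rewrite (is_exp_shift a0 m1E)// (is_exp_shift b0 m2E)//.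
rewrite [X in (_ * X)%E]muleACA -EFinM -expRD.
rewrite [LHS](muleA (expR _)%:E (expR _)%:E) -EFinM -expRD.
have -> : (a + b) * r + (- a * r + - b * r) = 0 by ring.
by rewrite expR0 mul1e.
Qed.

Lemma measurable_minpair : measurable_fun setT (fun z : R * R => Num.min z.1 z.2).
Proof. exact: measurable_minr. Qed.

Lemma measurable_diffpair : measurable_fun setT (fun z : R * R => z.1 - z.2).
Proof. exact: measurable_funB. Qed.

(** The minimum of two independent exponential variables is exponential and
    independent of their difference. It suffices to test the minimum against
    half-lines, and the event that the minimum exceeds r is a translate by
    (r, r), which the difference does not see. *)
Lemma exp_min_diff (C E : set R) : measurable C -> measurable E ->
  m12 [set z | C (Num.min z.1 z.2) /\ E (z.1 - z.2)] =
  (Exp (a + b)%R C * m12 [set z : R * R | E (z.1 - z.2)%R])%E.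
Proof.
move=> mC mE.
have mD : measurable [set z : R * R | E (z.1 - z.2)].
  by rewrite -[X in measurable X]setTI; exact: measurable_diffpair.
set D := [set z : R * R | E (z.1 - z.2)].
have finD : m12 D \is a fin_num.
  rewrite ge0_fin_numE ?measure_ge0//; apply: (@le_lt_trans _ _ (m12 setT)).
    by apply: le_measure; rewrite ?inE.
  by rewrite product_probabilityT ltry.
pose c := fine (m12 D).
have c0 : 0 <= c by rewrite fine_ge0.
have cE : m12 D = c%:E by rewrite fineK.
have ab0 : 0 < a + b by rewrite addr_gt0.
pose ea : probability (measurableTypeR R) R := exponential_prob (a + b).
have mid : measurable_fun setT (fun x : measurableTypeR R => x : R).
  by move=> _ A mA; rewrite setTI.
pose ma : {measure set R -> \bar R} := mscale (NngNum c0)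
  (pushforward (ea ab0) (fun x : measurableTypeR R => x : R)).
pose mb : {measure set R -> \bar R} :=
  pushforward (mrestr m12 mD) (fun z => Num.min z.1 z.2).
rewrite cE muleC -[RHS]/(ma mid C) -[LHS]/(mb measurable_minpair C).
(* the two measures on the line have mass P(difference in E) *)
apply: eq_measure_half_lines => // [|r].
  rewrite /mb /= /pushforward /mrestr preimage_setT setTI.
  by rewrite -/D cE ltry.
rewrite -[LHS]/(m12 ((fun z => Num.min z.1 z.2) @^-1` `]r, +oo[%classic `&` D)).
rewrite -[RHS]/(c%:E * Exp (a + b)%R (`]r, +oo[%classic : set R))%E Exp_half_line//.
have key s : 0 <= s -> m12 ((fun z => Num.min z.1 z.2) @^-1` `]s, +oo[%classic `&` D) =
    ((expR (- (a + b) * s))%:E * m12 D)%E.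
  move=> s0; rewrite -is_exp_pair_shift//; congr (m12 _).
  apply/seteqP; split => z /=; rewrite in_itv /= andbT lt_min.
    by move=> [/andP[-> ->]] H; split => //; rewrite /D /= opprB addrA subrK.
  by move=> [-> ->]; rewrite /D /= opprB addrA subrK.
have [r0|r0] := leP 0 r.
  by rewrite key// cE muleC.
rewrite mulr0 expR0 mule1 -cE; apply/eqP; rewrite eq_le; apply/andP; split.
  apply: le_measure; rewrite ?inE//; apply: measurableI => //.
  by rewrite -[X in measurable X]setTI; exact: measurable_minpair.
have := key 0 (lexx _); rewrite mulr0 expR0 mul1e => <-.
apply: le_measure; rewrite ?inE//.
- apply: measurableI => //.
  by rewrite -[X in measurable X]setTI; exact: measurable_minpair.
- apply: measurableI => //.
  by rewrite -[X in measurable X]setTI; exact: measurable_minpair.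
- apply: setSI => z /=; rewrite !in_itv /= !andbT; exact: lt_trans.
Qed.

End MinDiff.

Section BurkeCell.
Context {d : measure_display} {T : measurableType d} {R : realType}.
Variables (P : probability T R) (K : eqType).
Variables (X : K -> T -> R) (mu : K -> set R -> \bar R).
Hypothesis indX : indep_law P X mu.
Variables (a b : R) (i j l : K).
Hypotheses (a0 : 0 < a) (b0 : 0 < b).
Hypotheses (ij : i != j) (il : i != l) (jl : j != l).
Hypotheses (Xi : is_exp a (mu i)) (Xj : is_exp b (mu j)) (Xl : is_exp (a + b) (mu l)).

(** With m = min (I, J) and D = I - J, the input is (I, J) = (m + D^+, m + D^-)
    and the output is (w + D^+, w + D^-) together with m, where w is the weight
    of the cell. As m and w have the same law and m, w, D are independent, the
    output has the law of the input. *)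
Lemma burke_cell :
  indep_law P
    (fun k => if k == i then (fun t => Num.max (X i t - X j t) 0 + X l t)
         else if k == j then (fun t => Num.max (X j t - X i t) 0 + X l t)
         else if k == l then (fun t => Num.min (X i t) (X j t))
         else X k) mu.
Proof.
have mX := indX.1.
pose Vi : {RV P >-> R} := HB.pack (X i) (isMeasurableFun.Build _ _ _ _ _ (mX i)).
pose Vj : {RV P >-> R} := HB.pack (X j) (isMeasurableFun.Build _ _ _ _ _ (mX j)).
pose mi : probability R R := distribution P Vi.
pose mj : probability R R := distribution P Vj.
have miE : is_exp a mi.
  by move=> A mA; rewrite -Xi// -(indep_law_marginal i indX mA).
have mjE : is_exp b mj.
  by move=> A mA; rewrite -Xj// -(indep_law_marginal j indX mA).
pose F1 (z : R * R) := Num.min z.1 z.2.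
pose F2 (z : R * R) := z.1 - z.2.
have mF1 : measurable_fun setT F1 by exact: measurable_minpair.
have mF2 : measurable_fun setT F2 by exact: measurable_diffpair.
pose lam : set R -> \bar R := fun E => (mi \x mj)%E [set z | E (F2 z)].
have lamT : lam setT = 1%E by exact: product_probabilityT.
have := @indep_law_update2 _ _ _ P K X mu indX i j F1 F2 (mu l) lam ij mF1 mF2
  (indep_law_setT l indX) lamT.
have H1 A B : measurable A -> measurable B ->
    (pushforward P (X i) \x pushforward P (X j))%E
      [set z | A (F1 z) /\ B (F2 z)] = (mu l A * lam B)%E.
  by move=> mA mB; rewrite Xl//; exact: (exp_min_diff a0 b0 miE mjE).
move=> /(_ H1); set X1 := (fun k => _); set mu1 := (fun k => _) => ind1.
have li : (l == i) = false by rewrite eq_sym (negbTE il).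
have lj : (l == j) = false by rewrite eq_sym (negbTE jl).
have ji : (j == i) = false by rewrite eq_sym (negbTE ij).
have := @indep_law_swap _ _ _ P K X1 mu1 ind1 i l.
have H2 A : measurable A -> mu1 i A = mu1 l A by rewrite /mu1 eqxx li lj.
move=> /(_ H2); set X2 := (fun k => _) => ind2.
have mX2 := ind2.1.
pose Wi : {RV P >-> R} := HB.pack (X2 i) (isMeasurableFun.Build _ _ _ _ _ (mX2 i)).
pose Wj : {RV P >-> R} := HB.pack (X2 j) (isMeasurableFun.Build _ _ _ _ _ (mX2 j)).
have mF : measurable_fun setT (fun z => (F1 z, F2 z)).
  exact/measurable_fun_pair.
pose m' : {measure set (R * R) -> \bar R} :=
  pushforward (mi \x mj)%E (fun z => (F1 z, F2 z)).
have lawW (D : set (R * R)) : measurable D ->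
    (pushforward P (X2 i) \x pushforward P (X2 j))%E D = m' mF D.
  move=> mD; apply: (@product_measure_unique _ _ _ _ R (distribution P Wi)
    (distribution P Wj) (m' mF)) => //= A B mA mB.
  transitivity ((mu l A * lam B)%E); first by rewrite -H1.
  have -> : mu l A = mu1 i A by rewrite /mu1 eqxx.
  have -> : lam B = mu1 j B by rewrite /mu1 ji eqxx.
  by rewrite -(indep_law_marginal i ind2 mA) -(indep_law_marginal j ind2 mB).
pose G1 (z : R * R) := Num.max z.2 0 + z.1.
pose G2 (z : R * R) := Num.max (- z.2) 0 + z.1.
have mG1 : measurable_fun setT G1.
  by apply: measurable_funD => //; apply: measurable_maxr.
have mG2 : measurable_fun setT G2.
  by apply: measurable_funD => //; apply: measurable_maxr => //; exact: measurableT_comp.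
have G1F x y : G1 (F1 (x, y), F2 (x, y)) = x.
  by rewrite /G1 /F1 /F2 /=; case: (leP x y) => xy; case: (leP (x - y) 0); lra.
have G2F x y : G2 (F1 (x, y), F2 (x, y)) = y.
  by rewrite /G2 /F1 /F2 /=; case: (leP x y) => xy; case: (leP (- (x - y)) 0); lra.
have := @indep_law_update2 _ _ _ P K X2 mu1 ind2 i j G1 G2 (mu i) (mu j) ij mG1 mG2
  (indep_law_setT i indX) (indep_law_setT j indX).
have H3 A B : measurable A -> measurable B ->
    (pushforward P (X2 i) \x pushforward P (X2 j))%E
      [set z | A (G1 z) /\ B (G2 z)] = (mu i A * mu j B)%E.
  move=> mA mB; rewrite lawW; last first.
    rewrite (_ : [set z | _] = (G1 @^-1` A) `&` (G2 @^-1` B))//.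
    by apply: measurableI; rewrite -[X in measurable X]setTI; [exact: mG1|exact: mG2].
  rewrite Xi// Xj// -miE// -mjE// -[RHS]product_measure1E//.
  rewrite /m' /= /pushforward; congr ((_ \x _)%E _).
  by apply/seteqP; split => -[x y] /=; rewrite G1F G2F.
move=> /(_ H3) /(@indep_law_eq _ _ _ _ _ _ _ mu) H4.
rewrite (_ : (fun k => _) = (fun k : K =>
          if k == i
          then fun t : T => G1 (X2 i t, X2 j t)
          else if k == j then fun t : T => G2 (X2 i t, X2 j t) else X2 k)); last first.
  apply/funext => k; rewrite /X2 /X1 li lj ji (negbTE jl) !eqxx.
  case: (k == i); first by rewrite /G1.
  case: (k == j).
    by apply/funext => t; rewrite /G2 /F2 /= opprB.
  by case: (k == l).
apply: H4 => k A mA; rewrite /mu1; case: (eqVneq k i) => [->//|ki].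
by case: (eqVneq k j) => [->|].
Qed.
End BurkeCell.

(** * Exponential tilting *)

Section TiltMeasure.
Local Open Scope ereal_scope.
Context {d : measure_display} {T : measurableType d} {R : realType}.
Variables (P : probability T R) (g : T -> R).

Definition tilted (A : set T) : \bar R := \int[P]_(x in A) (g x)%:E.

Hypotheses (mg : measurable_fun setT g) (g0 : forall x, (0 <= g x)%R).
Hypothesis g1 : \int[P]_x (g x)%:E = 1.

Let tilted0 : tilted set0 = 0. Proof. by rewrite /tilted integral_set0. Qed.

Let tilted_ge0 A : 0 <= tilted A.
Proof. by apply: integral_ge0 => x _; rewrite lee_fin. Qed.

Let tilted_sigma_additive : semi_sigma_additive tilted.
Proof.
move=> F mF tF mUF; rewrite /tilted; apply: cvg_toP.
  apply: ereal_nondecreasing_is_cvgn => m n mn.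
  by apply: lee_sum_nneg_natr => // k _ _; apply: integral_ge0 => x _; rewrite lee_fin.
rewrite ge0_integral_bigcup//=.
- exact/measurable_funTS/measurableT_comp.
- by move=> x _; rewrite lee_fin.
Qed.

HB.instance Definition _ := isMeasure.Build _ _ _ tilted
  tilted0 tilted_ge0 tilted_sigma_additive.

Let tiltedT : tilted setT = 1. Proof. exact: g1. Qed.

HB.instance Definition _ := @Measure_isProbability.Build _ _ R tilted tiltedT.

Lemma tilted_probability : exists P' : probability T R, forall A, P' A = tilted A.
Proof. by exists tilted. Qed.

End TiltMeasure.

Section ExpTilt.
Context {d : measure_display} {T : measurableType d} {R : realType}.
Local Notation Exp a := (exponential_prob (a : R)).

(** Tilting by exp (theta x) turns rate a into rate a - theta. *)
Lemma exponential_pdf_tilt (a theta x : R) : 0 < a ->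
  (a - theta) / a * expR (theta * x) * exponential_pdf a x =
  exponential_pdf (a - theta) x.
Proof.
move=> a0; have [x0|x0] := ltP x 0; first by rewrite !lt0_exponential_pdf// mulr0.
rewrite !exponential_pdfE// -mulrA [expR _ * _]mulrCA -expRD.
rewrite mulrA divfK ?gt_eqF//; congr (_ * expR _); ring.
Qed.

Lemma integral_exp_tilt (nu : {measure set (measurableTypeR R) -> \bar R})
    (a theta : R) (A : set R) : 0 < a -> theta < a -> is_exp a nu -> measurable A ->
  (\int[nu]_y ((\1_A y * ((a - theta) / a * expR (theta * y)))%:E) =
   Exp (a - theta)%R A)%E.
Proof.
move=> a0 ta nuE mA.
have at0 : 0 <= (a - theta) / a by rewrite divr_ge0 ?subr_ge0 ?ltW.
have mh : measurable_fun setT (fun y : measurableTypeR R =>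
    (a - theta) / a * expR (theta * y)).
  by apply: measurable_funM => //; apply: measurableT_comp => //; exact: measurable_funM.
rewrite (@ge0_integral_density _ _ _ lebesgue_measure nu (exponential_pdf a))//.
- rewrite /exponential_prob [RHS]integral_mkcond /=; apply: eq_integral => y _.
  rewrite patchE -EFinM -(mulrA (\1_A y)) exponential_pdf_tilt// indicE.
  by case: ifPn; rewrite ?mul1r ?mul0r.
- exact: measurable_exponential_pdf.
- by move=> y; apply: exponential_pdf_ge0; exact: ltW.
- apply/measurable_EFinP; apply: measurable_funM => //.
- by move=> y; rewrite lee_fin mulr_ge0// mulr_ge0// expR_ge0.
Qed.

Variables (K : eqType) (X : K -> T -> R).

(** Tilting the underlying probability by one coordinate changes the law of that
    coordinate only and keeps independence. Working with a new probability on the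
    same space keeps all random variables in place, so that identities proved for
    every probability can be applied after the change of measure. *)
Lemma indep_law_tilt (P : probability T R) (mu : K -> set R -> \bar R)
    (i : K) (a theta : R) :
  indep_law P X mu -> 0 < a -> theta < a -> is_exp a (mu i) ->
  exists P' : probability T R,
    indep_law P' X (fun k => if k == i then Exp (a - theta) else mu k) /\
    forall H : T -> \bar R, measurable_fun setT H -> (forall t, 0 <= H t)%E ->
      (\int[P]_t ((expR (theta * X i t))%:E * H t) =
       (a / (a - theta))%:E * \int[P']_t H t)%E.
Proof.
move=> indX a0 ta mui; have mX := indX.1.
have at0 : 0 < a - theta by rewrite subr_gt0.
pose h (y : R) := (a - theta) / a * expR (theta * y).
have h0 y : 0 <= h y by rewrite mulr_ge0// ?expR_ge0// divr_ge0// ltW.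
have mh : measurable_fun setT h.
  by apply: measurable_funM => //; apply: measurableT_comp => //; exact: measurable_funM.
pose g t := h (X i t).
have mg : measurable_fun setT g by exact: measurableT_comp.
have g0 t : 0 <= g t by exact: h0.
pose Ev (s : seq K) (A : K -> set R) := [set t | forall k, k \in s -> A k (X k t)].
have key (s : seq K) (A : K -> set R) : uniq (i :: s) -> (forall k, measurable (A k)) ->
    (\int[P]_(t in Ev (i :: s) A) (g t)%:E =
     Exp (a - theta) (A i) * \prod_(k <- s) mu k (A k))%E.
  move=> us mA; set C := Ev s A.
  have mC : measurable C by exact: measurable_event.
  have mEv : measurable (Ev (i :: s) A) by exact: measurable_event.
  have nis : i \notin s by case/andP: us.
  have PC : P C = (\prod_(k <- s) mu k (A k))%E by apply: indX.2 => //; case/andP: us.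
  have PCfin : P C \is a fin_num by exact: fin_num_measure.
  have c0 : 0 <= fine (P C) by rewrite fine_ge0.
  pose W : {measure set T -> \bar R} := mrestr P mC.
  have mXi : measurable_fun setT (X i : T -> measurableTypeR R) by exact: mX.
  have nuE B : measurable B -> P ((X i @^-1` B) `&` C) = (P C * Exp a B)%E.
    move=> mB; pose A' k := if k == i then B else A k.
    have mA' k : measurable (A' k) by rewrite /A'; case: ifP.
    have := indX.2 (i :: s) A' us mA'; rewrite big_cons {2}/A' eqxx mui// muleC.
    rewrite (_ : \prod_(k <- s) mu k (A' k) = P C)%E; last first.
      rewrite PC; apply: eq_big_seq => k ks; rewrite /A' ifF//.
      by apply/negbTE; apply: contraNneq nis => <-.
    move=> <-; congr (P _); apply/seteqP; split => t /=.
      move=> [Bt Ct] k; rewrite inE /A'; case: eqP => [->//|_] /=; exact: Ct.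
    move=> Ht; split; first by have := Ht i; rewrite mem_head /A' eqxx; apply.
    move=> k ks; have := Ht k; rewrite inE ks orbT /A' => /(_ isT).
    by rewrite ifF//; apply/negbTE; apply: contraNneq nis => <-.
  pose nu : {measure set (measurableTypeR R) -> \bar R} :=
    pushforward W (X i : T -> measurableTypeR R).
  pose ea : probability (measurableTypeR R) R := exponential_prob a.
  pose sc : {measure set (measurableTypeR R) -> \bar R} :=
    mscale (NngNum c0) (ea a0).
  transitivity (\int[P]_t (((\1_(A i) (X i t) * h (X i t))%:E) * (\1_C t)%:E))%E.
    rewrite [LHS]integral_mkcond/=; apply: eq_integral => t _.
    rewrite patchE -EFinM !indicE.
    have -> : (t \in Ev (i :: s) A) = (X i t \in A i) && (t \in C).
      apply/idP/idP; rewrite !inE => H.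
        apply/andP; split; rewrite inE; first by apply: H; rewrite mem_head.
        by move=> k ks; apply: H; rewrite inE ks orbT.
      case/andP: H; rewrite !inE => H1 H2 k; rewrite inE => /orP[/eqP->//|]; exact: H2.
    by do 2 case: (_ \in _); rewrite /= ?mul1r ?mul0r ?mulr1 ?mulr0.
  have mAh : measurable_fun setT (fun y : measurableTypeR R => (\1_(A i) y * h y)%:E).
    apply/measurable_EFinP; apply: measurable_funM; last exact: mh.
    by apply: measurable_indic; exact: mA.
  have Ah0 y : (0 <= (\1_(A i) y * h y)%:E)%E by rewrite lee_fin mulr_ge0.
  rewrite -(@ge0_integral_density _ _ _ P W (\1_C))//; last 2 first.
  - move=> B mB; rewrite integral_indic// setIC.
    by rewrite /W /= /mrestr setIC.
  - by apply/measurable_EFinP; apply/measurable_EFinP; exact: (measurableT_comp mAh).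
  transitivity (\int[nu mXi]_y (\1_(A i) y * h y)%:E)%E.
    apply/esym; have := @ge0_integral_pushforward _ _ _ _ _ _ mXi W setT _ measurableT mAh.
    by apply => y _; exact: Ah0.
  transitivity (\int[sc]_y (\1_(A i) y * h y)%:E)%E.
    apply: eq_measure_integral => B mB _.
    rewrite -[LHS]/(P ((X i @^-1` B) `&` C)) nuE//.
    by rewrite -[RHS]/((fine (P C))%:E * Exp a B)%E fineK.
  rewrite /sc ge0_integral_mscale//= fineK// integral_exp_tilt//.
  by rewrite PC muleC.
have g1 : (\int[P]_t (g t)%:E = 1)%E.
  have := key [::] (fun=> setT) isT (fun=> measurableT).
  rewrite (_ : Ev _ _ = setT) => [->|]; last by apply/seteqP; split.
  by rewrite big_nil mule1 /exponential_prob integral_exponential_pdf.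
have [P' P'E] := tilted_probability mg g0 g1.
exists P'; split.
  apply: (@indep_law_ext _ _ _ _ _ [:: i]) => //.
    move=> k; rewrite inE => /eqP ->; rewrite eqxx.
    by rewrite /exponential_prob integral_exponential_pdf.
  move=> s A us mA; rewrite P'E /tilted key// big_cons eqxx; congr (_ * _)%E.
  apply: eq_big_seq => k ks; rewrite ifF//; apply/negbTE.
  by move: us => /= /andP[nis _]; apply: contraNneq nis => <-.
move=> H mH H0.
have P'E2 A : measurable A -> P' A = (\int[P]_(x in A) (g x)%:E)%E by move=> _; exact: P'E.
rewrite (ge0_integral_density mg g0 P'E2)//.
rewrite -ge0_integralZl//; last 3 first.
- by apply: emeasurable_funM => //; exact/measurable_EFinP.
- by move=> t _; rewrite mule_ge0// lee_fin.
- by rewrite lee_fin divr_ge0// ltW.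
apply: eq_integral => t _; rewrite [RHS]muleCA -EFinM muleC; congr (_ * _%:E)%E.
by rewrite /g /h; field; rewrite !gt_eqF.
Qed.

End ExpTilt.

(** * Moments of sums and Chernoff bounds *)

Section SumTilt.
Context {d : measure_display} {T : measurableType d} {R : realType}.
Variables (K : eqType) (X : K -> T -> R).
Local Notation Exp a := (exponential_prob (a : R)).

Lemma indep_law_tilt_seq (s : seq K) (P : probability T R)
    (mu : K -> set R -> \bar R) (a theta : R) :
  indep_law P X mu -> 0 < a -> theta < a -> uniq s ->
  (forall k, k \in s -> is_exp a (mu k)) ->
  exists P' : probability T R,
    indep_law P' X (fun k => if k \in s then Exp (a - theta) else mu k) /\
    forall H : T -> \bar R, measurable_fun setT H -> (forall t, 0 <= H t)%E ->
      (\int[P]_t ((expR (theta * \sum_(k <- s) X k t))%:E * H t) =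
       ((a / (a - theta)) ^+ size s)%:E * \int[P']_t H t)%E.
Proof.
move=> + a0 ta; elim: s P mu => [|i s IH] P mu indX us mus.
  exists P; split=> // H mH H0; rewrite expr0 mul1e.
  by apply: eq_integral => t _; rewrite big_nil mulr0 expR0 mul1e.
have /andP[nis us'] := us.
have [P1 [ind1 P1H]] := indep_law_tilt indX a0 ta (mus i (mem_head _ _)).
have mus1 k : k \in s -> is_exp a (if k == i then Exp (a - theta) else mu k).
  move=> ks; rewrite ifF; first by apply: mus; rewrite inE ks orbT.
  by apply/negbTE; apply: contraNneq nis => <-.
have [P2 [ind2 P2H]] := IH _ _ ind1 us' mus1.
exists P2; split.
  apply: indep_law_eq ind2 => k A mA; rewrite inE.
  by case: (k \in s); rewrite ?orbT//; case: (k == i).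
move=> H mH H0; have mX := indX.1.
have mS : measurable_fun setT (fun t => \sum_(k <- s) X k t).
  by apply: measurable_sum.
have mE : measurable_fun setT (fun t => (expR (theta * \sum_(k <- s) X k t))%:E).
  by apply/measurable_EFinP; apply: measurableT_comp => //; exact: measurable_funM.
under eq_integral do rewrite big_cons mulrDr expRD EFinM -muleA.
rewrite P1H; last 2 first.
- exact: emeasurable_funM.
- by move=> t; rewrite mule_ge0// lee_fin expR_ge0.
by rewrite P2H// muleA -EFinM -exprS.
Qed.

Lemma integral_exp_sum (s : seq K) (P : probability T R)
    (mu : K -> set R -> \bar R) (a theta : R) :
  indep_law P X mu -> 0 < a -> theta < a -> uniq s ->
  (forall k, k \in s -> is_exp a (mu k)) ->
  (\int[P]_t (expR (theta * \sum_(k <- s) X k t))%:E =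
   ((a / (a - theta)) ^+ size s)%:E)%E.
Proof.
move=> indX a0 ta us mus.
have [P' [_ PH]] := indep_law_tilt_seq indX a0 ta us mus.
have := PH (cst 1%E) (measurable_cst _) (fun=> lee01).
under eq_integral do rewrite mule1.
move=> ->; rewrite (_ : (\int[P']_t cst 1 t = 1)%E) ?mule1//.
by rewrite integral_cst// mul1e; exact: probability_setT.
Qed.

End SumTilt.

Section Chernoff.
Context {d : measure_display} {T : measurableType d} {R : realType}.
Variable P : probability T R.

(** The sign of theta decides between an upper and a lower tail. *)
Lemma chernoff (Z : T -> R) (theta b M : R) : measurable_fun setT Z ->
  (\int[P]_t (expR (theta * Z t))%:E = M%:E)%E ->
  (P [set t | (theta * b <= theta * Z t)%R] <= (M * expR (- (theta * b)))%:E)%E.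
Proof.
move=> mZ ME; set A := [set t | _].
have mtZ : measurable_fun setT (fun t => theta * Z t) by exact: measurable_funM.
have mA : measurable A.
  rewrite (_ : A = (fun t => theta * Z t) @^-1` `[theta * b, +oo[%classic).
    exact: measurable_preimageT.
  by apply/seteqP; split => t /=; rewrite in_itv /= andbT.
have mE : measurable_fun setT (fun t => (expR (theta * Z t))%:E).
  by apply/measurable_EFinP; exact: measurableT_comp.
rewrite expRN EFinM lee_pdivlMr ?expR_gt0// -ME.
have iA : (\int[P]_t (\1_A t)%:E = P A)%E by rewrite integral_indic// setIT.
have mI : measurable_fun setT (fun t => (\1_A t : R)%:E) by exact/measurable_EFinP.
rewrite -iA -ge0_integralZr ?lee_fin ?expR_ge0//.
apply: ge0_le_integral => //.
- by apply: emeasurable_funM => //; exact/measurable_EFinP.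
- move=> t _; rewrite -EFinM lee_fin indicE.
  have [|] := boolP (t \in A); last by rewrite mul0r expR_ge0.
  by rewrite inE mul1r /A /= ler_expR.
Qed.

End Chernoff.

(** * Last-passage times and paths *)

Section LastPassage.
Context {R : realType}.
Implicit Types (x y : site -> R) (i j : nat).

(** Passage time from the origin by the recursion on the last step. The recursion
    on the axes does not compare with 0, so that increments along the axes are
    exactly the weights. *)
Fixpoint lastpass x (i : nat) : nat -> R :=
  fix row (j : nat) : R := x (i, j) +
    match i, j with
    | O, O => 0
    | i'.+1, O => lastpass x i' O
    | O, j'.+1 => row j'
    | i'.+1, j'.+1 => Num.max (lastpass x i' j) (row j')
    end.

Lemma lastpass00 x : lastpass x 0 0 = x (0, 0)%N.
Proof. by rewrite /= addr0. Qed.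

Lemma lastpassS0 x i : lastpass x i.+1 0 = x (i.+1, 0)%N + lastpass x i 0.
Proof. by []. Qed.

Lemma lastpass0S x j : lastpass x 0 j.+1 = x (0, j.+1)%N + lastpass x 0 j.
Proof. by []. Qed.

Lemma lastpassSS x i j : lastpass x i.+1 j.+1 =
  x (i.+1, j.+1) + Num.max (lastpass x i j.+1) (lastpass x i.+1 j).
Proof. by []. Qed.

Arguments lastpass : simpl never.

Definition lpE := (lastpass00, lastpassS0, lastpass0S, lastpassSS).

Lemma grid_ind (Q : nat -> nat -> Prop) :
  Q 0%N 0%N -> (forall i, Q i 0%N -> Q i.+1 0%N) ->
  (forall j, Q 0%N j -> Q 0%N j.+1) ->
  (forall i j, Q i j.+1 -> Q i.+1 j -> Q i.+1 j.+1) -> forall i j, Q i j.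
Proof.
move=> Q00 QS0 Q0S QSS; elim=> [|i IH]; first by elim=> // j; exact: Q0S.
by elim=> [|j IHj]; [exact: QS0|exact: QSS].
Qed.

Lemma ler_lastpass x y i j :
  (forall a b, (a <= i)%N -> (b <= j)%N -> x (a, b) <= y (a, b)) ->
  lastpass x i j <= lastpass y i j.
Proof.
move: i j; apply: grid_ind => [|i IH|j IH|i j IH1 IH2] xy; rewrite !lpE.
- exact: xy.
- by apply: lerD; [exact: xy|apply: IH => a b ai; apply: xy; exact: leqW].
- by apply: lerD; [exact: xy|apply: IH => a b ai bj; apply: xy; rewrite // leqW].
- apply: lerD; first exact: xy.
  have I1 := IH1 (fun a b ai bj => xy a b (leqW ai) bj).
  have I2 := IH2 (fun a b ai bj => xy a b ai (leqW bj)).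
  by rewrite ge_max !le_max I1 I2 orbT.
Qed.

Lemma eq_lastpass x y i j :
  (forall a b, (a <= i)%N -> (b <= j)%N -> x (a, b) = y (a, b)) ->
  lastpass x i j = lastpass y i j.
Proof.
by move=> xy; apply/eqP; rewrite eq_le !ler_lastpass// => a b ai bj; rewrite xy.
Qed.

Section Nonneg.
Variable x : site -> R.
Hypothesis x0 : forall p, 0 <= x p.

Lemma lastpass_ge0 i j : 0 <= lastpass x i j.
Proof.
move: i j; apply: grid_ind => [|i IH|j IH|i j IH1 IH2]; rewrite !lpE ?addr_ge0//.
by rewrite le_max IH1.
Qed.

Lemma lastpass_stepl i j : x (i.+1, j) + lastpass x i j <= lastpass x i.+1 j.
Proof. by case: j => [|j]; rewrite ?lastpassS0// lastpassSS lerD2l le_max lexx. Qed.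

Lemma lastpass_stepr i j : x (i, j.+1) + lastpass x i j <= lastpass x i j.+1.
Proof. by case: i => [|i]; rewrite ?lastpass0S// lastpassSS lerD2l le_max lexx orbT. Qed.

Lemma lastpass_mono a b i j : (a <= i)%N -> (b <= j)%N ->
  lastpass x a b <= lastpass x i j.
Proof.
move=> /subnKC <- /subnKC <-; elim: (i - a)%N => [|k IH].
  rewrite addn0; elim: (j - b)%N => [|l IH]; first by rewrite addn0.
  rewrite addnS; apply: le_trans IH _; apply: le_trans (lastpass_stepr _ _).
  by rewrite lerDr.
rewrite addnS; apply: le_trans IH _; apply: le_trans (lastpass_stepl _ _).
by rewrite lerDr.
Qed.

Lemma path_weight_le (u v : site) (s : seq site) :
  path up_right_step u s -> last u s = v ->
  \sum_(p <- s) x p + lastpass x u.1 u.2 <= lastpass x v.1 v.2.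
Proof.
elim: s u => [|a s IH] u /=; first by move=> _ <-; rewrite big_nil add0r.
move=> /andP[/orP ua sp] sv; apply: le_trans (IH a sp sv).
rewrite big_cons (addrC (x a)) -addrA lerD2l.
case: ua => /eqP -> /=; first exact: lastpass_stepl.
exact: lastpass_stepr.
Qed.

End Nonneg.

Lemma path_attained x i j : exists s,
  [/\ path up_right_step (0, 0)%N s, last (0, 0)%N s = (i, j)
    & \sum_(p <- (0, 0)%N :: s) x p = lastpass x i j].
Proof.
have ext (u v : site) s : path up_right_step (0, 0)%N s -> last (0, 0)%N s = u ->
    up_right_step u v -> path up_right_step (0, 0)%N (rcons s v) /\
    \sum_(p <- (0, 0)%N :: rcons s v) x p = x v + \sum_(p <- (0, 0)%N :: s) x p.
  move=> sp su uv; rewrite rcons_path sp su uv; split=> //.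
  by rewrite -cats1 -cat_cons big_cat /= big_seq1 addrC.
have sl a b : up_right_step (a, b) (a.+1, b) by rewrite /up_right_step eqxx.
have sr a b : up_right_step (a, b) (a, b.+1) by rewrite /up_right_step eqxx orbT.
move: i j; apply: grid_ind => [|i [s [sp sl' sE]]|j [s [sp sl' sE]]|i j].
- by exists [::]; split=> //; rewrite big_seq1 lastpass00.
- have [p1 p2] := ext _ _ _ sp sl' (sl _ _).
  by exists (rcons s (i.+1, 0)%N); rewrite last_rcons p2 sE lpE.
- have [p1 p2] := ext _ _ _ sp sl' (sr _ _).
  by exists (rcons s (0, j.+1)%N); rewrite last_rcons p2 sE lpE.
move=> [s [sp sl' sE]] [s' [sp' sl'' sE']].
rewrite lpE; have [le|le] := leP (lastpass x i j.+1) (lastpass x i.+1 j).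
  have [p1 p2] := ext _ _ _ sp' sl'' (sr _ _).
  by exists (rcons s' (i.+1, j.+1)%N); rewrite last_rcons p2 sE'.
have [p1 p2] := ext _ _ _ sp sl' (sl _ _).
by exists (rcons s (i.+1, j.+1)%N); rewrite last_rcons p2 sE.
Qed.

Definition flip (m n : nat) (p : site) : site := (m - p.1, n - p.2)%N.

Lemma path_flip (m n : nat) (u v : site) (s : seq site) :
  path up_right_step u s -> last u s = v -> (v.1 <= m)%N -> (v.2 <= n)%N ->
  exists s', [/\ path up_right_step (flip m n v) s',
    last (flip m n v) s' = flip m n u &
    flip m n v :: s' = rev (map (flip m n) (u :: s))].
Proof.
move=> sp sv vm vn.
have le := up_right_path_le sp sv.
elim: s u sp sv le => [|a s IH] u /=.
  by move=> _ -> _; exists [::].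
move=> /andP[ua sp] sv le.
have le' p : p \in a :: s -> (p.1 <= v.1)%N && (p.2 <= v.2)%N.
  by move=> ps; apply: le; rewrite inE ps orbT.
have [s' [p1 p2 p3]] := IH a sp sv le'.
exists (rcons s' (flip m n u)); split; last 2 first.
- by rewrite last_rcons.
- by rewrite -rcons_cons p3 /= -rev_cons.
rewrite rcons_path p1 p2 /=.
have /andP[a1 a2] := le' a (mem_head _ _).
have am := leq_trans a1 vm; have an := leq_trans a2 vn.
move: ua; rewrite /up_right_step /flip => /orP[]/eqP aE; apply/orP.
  by left; rewrite aE /= subnSK//; move: am; rewrite aE.
by right; rewrite aE /= subnSK//; move: an; rewrite aE.
Qed.

(** Reversing paths exchanges the two end points of the rectangle. *)
Lemma lastpass_flip (x : site -> R) (m n : nat) :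
  lastpass (fun p => x (flip m n p)) m n = lastpass x m n.
Proof.
suff le (y : site -> R) : lastpass y m n <= lastpass (fun p => y (flip m n p)) m n.
  apply/eqP; rewrite eq_le le andbT.
  have := le (fun p => x (flip m n p)).
  rewrite [X in _ <= X -> _](@eq_lastpass _ x)// => a b am bn.
  by rewrite /flip /= !subKn.
have [s [sp sl sE]] := path_attained y m n.
have [|//|s' [p1 p2 p3]] := @path_flip m n _ _ _ sp sl; first by rewrite leqnn.
have := @path_weight_le (fun p => y (flip m n p)) _ _ _ p1 p2.
rewrite {3 4}/flip /= !subnn !subn0 lastpass00 -sE; apply: le_trans.
have -> : \sum_(p <- s') y (flip m n p) + y (flip m n (0, 0)%N) =
   \sum_(p <- flip m n (m, n) :: s') y (flip m n p).
  by rewrite big_cons addrC /flip /= !subnn.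
rewrite p3 big_rev big_map big_seq [leRHS]big_seq; apply: ler_sum => p ps.
have /andP[] := up_right_path_le sp sl ps; rewrite /flip /= => p1m p2n.
by rewrite !subKn// -surjective_pairing.
Qed.

End LastPassage.
#[global] Arguments lastpass {R} x i j : simpl never.

(** * Increments and their comparison *)

Section Increments.
Context {R : realType}.
Implicit Types (x y : site -> R) (i j m n : nat).

(** Increments along horizontal and vertical steps; meant for a positive first,
    respectively second, coordinate. *)
Definition hinc x i j := lastpass x i j - lastpass x i.-1 j.
Definition vinc x i j := lastpass x i j - lastpass x i j.-1.

Lemma hincS0 x i : hinc x i.+1 0 = x (i.+1, 0)%N.
Proof. by rewrite /hinc lpE addrK. Qed.

Lemma vinc0S x j : vinc x 0 j.+1 = x (0, j.+1)%N.
Proof. by rewrite /vinc lpE addrK. Qed.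

Lemma hincSS x i j : hinc x i.+1 j.+1 =
  Num.max (hinc x i.+1 j - vinc x i j.+1) 0 + x (i.+1, j.+1).
Proof.
rewrite /hinc /vinc /= !lpE.
by case: (leP (lastpass x i j.+1) (lastpass x i.+1 j)) => h;
  case: (leP (lastpass x i.+1 j - lastpass x i j - (lastpass x i j.+1 - lastpass x i j)) 0) => h2;
  move: h h2; set u := lastpass x i j.+1; set v := lastpass x i.+1 j; lra.
Qed.

Lemma vincSS x i j : vinc x i.+1 j.+1 =
  Num.max (vinc x i j.+1 - hinc x i.+1 j) 0 + x (i.+1, j.+1).
Proof.
rewrite /hinc /vinc /= !lpE.
by case: (leP (lastpass x i j.+1) (lastpass x i.+1 j)) => h;
  case: (leP (lastpass x i j.+1 - lastpass x i j - (lastpass x i.+1 j - lastpass x i j)) 0) => h2;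
  move: h h2; set u := lastpass x i j.+1; set v := lastpass x i.+1 j; lra.
Qed.

Lemma lastpass_hinc x k i j : (k <= i)%N ->
  lastpass x i j = lastpass x k j + \sum_(k.+1 <= l < i.+1) hinc x l j.
Proof.
move=> /subnKC <-; elim: (i - k)%N => [|l IH].
  by rewrite addn0 big_geq// addr0.
by rewrite addnS big_nat_recr ?ltnS ?leq_addr//= addrA -IH /hinc /= addrC subrK.
Qed.

Lemma lastpass_vinc x i j :
  lastpass x i j = lastpass x i 0 + \sum_(1 <= l < j.+1) vinc x i l.
Proof.
elim: j => [|j IH]; first by rewrite big_geq// addr0.
by rewrite big_nat_recr//= addrA -IH /vinc /= addrC subrK.
Qed.

Lemma lastpass_row0 x i : lastpass x i 0 = x (0, 0)%N + \sum_(1 <= l < i.+1) x (l, 0)%N.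
Proof.
elim: i => [|i IH]; first by rewrite lpE big_geq// addr0.
by rewrite lpE big_nat_recr//= addrA -IH addrC.
Qed.

(** The map sending the increments below and to the left of a cell to those above
    and to the right is monotone: horizontal increments increase with horizontal
    ones and decrease with vertical ones. The comparison on the axes therefore
    propagates to the whole quadrant. *)
Lemma crossing x y i j :
  (forall a, x (a.+1, 0)%N <= y (a.+1, 0)%N) ->
  (forall b, y (0, b.+1)%N <= x (0, b.+1)%N) ->
  (forall a b, x (a.+1, b.+1) = y (a.+1, b.+1)) ->
  hinc x i.+1 j <= hinc y i.+1 j /\ vinc y i j.+1 <= vinc x i j.+1.
Proof.
move=> bot left_ bulk; move: i j.
have H : forall i j, (forall a, (a <= i)%N -> hinc x a.+1 j <= hinc y a.+1 j) /\
    vinc y i j.+1 <= vinc x i j.+1.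
  move=> i j; elim: j i => [|j IHj] i.
    split; first by move=> a _; rewrite !hincS0.
    elim: i => [|i IH]; first by rewrite !vinc0S.
    rewrite !vincSS bulk lerD2r ge_max !le_max lexx orbT andbT.
    by rewrite lerB// !hincS0.
  suff Hh : (forall a, hinc x a.+1 j.+1 <= hinc y a.+1 j.+1).
    split=> [a _|]; first exact: Hh.
    elim: i => [|i IH]; first by rewrite !vinc0S.
    rewrite !vincSS bulk lerD2r ge_max !le_max lexx orbT andbT.
    by rewrite lerB.
  move=> a; have [_ v] := IHj a; have [h _] := IHj a.
  rewrite !hincSS bulk lerD2r ge_max !le_max lexx orbT andbT.
  by rewrite lerB// h.
by move=> i j; have [h v] := H i j; split=> //; exact: h.
Qed.

Definition no_bottom x : site -> R := fun p => if p.2 == 0%N then 0 else x p.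
Definition no_left x : site -> R := fun p => if p.1 == 0%N then 0 else x p.
Definition bulk x : site -> R := no_bottom (no_left x).

(** A path uses at most one of the two axes after the origin, hence cannot profit
    from the weights of both. *)
Lemma lastpass_max x i j : (forall p, 0 <= x p) -> x (0, 0)%N = 0 ->
  lastpass x i j = Num.max (lastpass (no_left x) i j) (lastpass (no_bottom x) i j).
Proof.
move=> x0 x00; move: i j; apply: grid_ind => [|i IH|j IH|i j IH1 IH2]; rewrite !lpE.
- by rewrite /no_left /no_bottom /= maxxx.
- have -> : lastpass (no_bottom x) i 0 = 0.
    by rewrite lastpass_row0 /no_bottom /= add0r big1.
  have l0 : 0 <= lastpass (no_left x) i 0.
    by apply: lastpass_ge0 => p; rewrite /no_left; case: ifP.
  rewrite {1}/no_left {1}/no_bottom /= add0r max_l ?addr_ge0//; congr (_ + _).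
  rewrite !lastpass_row0 {1}/no_left /= x00; congr (_ + _).
  by apply: eq_big_nat => k /andP[k0 _]; rewrite /no_left /= gtn_eqF.
- have E0 : lastpass (no_left x) 0 j = 0.
    by elim: (j) => [|k IHk]; rewrite lpE /no_left ?addr0//= add0r.
  have l0 : 0 <= lastpass (no_bottom x) 0 j.
    by apply: lastpass_ge0 => p; rewrite /no_bottom; case: ifP.
  rewrite E0 {1}/no_left {1}/no_bottom /= add0r max_r ?addr_ge0//; congr (_ + _).
  by rewrite IH E0 max_r.
- rewrite IH1 IH2 /no_left /no_bottom /= -addr_maxr; congr (_ + _).
  by rewrite maxACA.
Qed.

(** If the left boundary alone attains the full passage time, then the horizontal
    increments of the model with left boundary are at least those of the full
    model, and by [crossing] removing the left boundary only increases them. *)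
Lemma bulk_increment_ge x k i j : (forall p, 0 <= x p) -> x (0, 0)%N = 0 ->
  (k <= i)%N -> lastpass (no_left x) i j <= lastpass (no_bottom x) i j ->
  lastpass x i j - lastpass x k j <= lastpass (bulk x) i j - lastpass (bulk x) k j.
Proof.
move=> x0 x00 ki le.
have -> : lastpass x i j = lastpass (no_bottom x) i j by rewrite lastpass_max// max_r.
apply: (@le_trans _ _ (lastpass (no_bottom x) i j - lastpass (no_bottom x) k j)).
  rewrite lerD2l lerN2; apply: ler_lastpass => a b _ _.
  by rewrite /no_bottom; case: ifP.
rewrite !(lastpass_hinc _ _ ki) !(addrC (lastpass _ k j)) !addrK.
rewrite big_nat [leRHS]big_nat; apply: ler_sum => l /andP[kl _].
case: l kl => // l _; apply: (proj1 (@crossing (no_bottom x) (bulk x) l j _ _ _)).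
- by [].
- by move=> b; rewrite /bulk /no_bottom /no_left /=.
- by [].
Qed.

End Increments.

(** * The Burke property on a rectangle and a moment identity *)

Section BurkeRun.
Context {R : realType}.

(** One cell c = (i, j) is swept: the sites (i, 0) and (0, j) carry the current
    increments below and to the left of c, and receive those above and to the
    right; c receives the dual weight, so that no randomness is lost. *)
Definition burke_step (y : site -> R) (c : site) : site -> R := fun p =>
  if p == (c.1, 0%N) then Num.max (y (c.1, 0%N) - y (0%N, c.2)) 0 + y c
  else if p == (0%N, c.2) then Num.max (y (0%N, c.2) - y (c.1, 0%N)) 0 + y c
  else if p == c then Num.min (y (c.1, 0%N)) (y (0%N, c.2))
  else y p.

Fixpoint row_cells (m j : nat) : seq site :=
  if m is m'.+1 then rcons (row_cells m' j) (m, j) else [::].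

Fixpoint grid_cells (m n : nat) : seq site :=
  if n is n'.+1 then grid_cells m n' ++ row_cells m n else [::].

Lemma mem_row_cells m j c : c \in row_cells m j -> [/\ (0 < c.1)%N, (c.1 <= m)%N & c.2 = j].
Proof.
elim: m => // m IH; rewrite mem_rcons inE => /orP[/eqP->//|/IH[c0 cm cj]].
by split=> //; exact: leqW.
Qed.

Lemma mem_grid_cells m n c : c \in grid_cells m n ->
  [/\ (0 < c.1)%N, (c.1 <= m)%N, (0 < c.2)%N & (c.2 <= n)%N].
Proof.
elim: n => // n IH; rewrite mem_cat => /orP[/IH[? ? ? ?]|/mem_row_cells[? ? ->]//].
by split=> //; exact: leqW.
Qed.

Lemma burke_row (x y : site -> R) (m j k : nat) : (k <= m)%N ->
  (forall i, (0 < i <= m)%N -> y (i, 0%N) = hinc x i j) ->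
  y (0%N, j.+1) = x (0%N, j.+1) ->
  (forall i, (0 < i <= m)%N -> y (i, j.+1) = x (i, j.+1)) ->
  let y' := foldl burke_step y (row_cells k j.+1) in
  [/\ forall i, (0 < i <= k)%N -> y' (i, 0%N) = hinc x i j.+1,
      forall i, (k < i <= m)%N -> y' (i, 0%N) = hinc x i j,
      y' (0%N, j.+1) = vinc x k j.+1,
      forall i, (k < i <= m)%N -> y' (i, j.+1) = x (i, j.+1) &
      forall i l, l != 0%N -> l != j.+1 -> y' (i, l) = y (i, l)].
Proof.
move=> km yh yv yx; elim: k km => [|k IH] km /=.
  split=> //; first by move=> i /andP[]; case: i.
  by rewrite yv vinc0S.
have [h1 h2 h3 h4 h5] := IH (ltnW km).
rewrite foldl_rcons; set z := foldl _ _ _ in h1 h2 h3 h4 h5 *.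
have kk : (k < k.+1 <= m)%N by rewrite ltnSn.
split.
- move=> i /andP[i0]; rewrite leq_eqVlt => /orP[/eqP->|ik].
    by rewrite /burke_step /= eqxx h2// h3 h4// hincSS.
  rewrite /burke_step /= !xpair_eqE eqxx andbT /= (ltn_eqF ik) (gtn_eqF i0) /=.
  by rewrite h1// i0 -ltnS.
- move=> i /andP[ki im].
  rewrite /burke_step /= !xpair_eqE eqxx andbT /= (gtn_eqF ki) (gtn_eqF (leq_ltn_trans _ ki))//=.
  by rewrite h2// (ltnW ki).
- by rewrite /burke_step /= !xpair_eqE /= eqxx h2// h3 h4// vincSS.
- move=> i /andP[ki im].
  rewrite /burke_step /= !xpair_eqE eqxx andbF andbT (gtn_eqF ki) /=.
  by rewrite (gtn_eqF (leq_ltn_trans _ ki))//= h4// (ltnW ki).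
- move=> i l l0 lj.
  by rewrite /burke_step /= !xpair_eqE (negbTE l0) (negbTE lj) !andbF h5.
Qed.

(** Sweeping the rectangle row by row leaves the increments along its north side
    at the sites (i, 0) and along its east side at the sites (0, j). *)
Lemma burke_grid (x : site -> R) (m n : nat) :
  let y' := foldl burke_step x (grid_cells m n) in
  [/\ forall i, (0 < i <= m)%N -> y' (i, 0%N) = hinc x i n,
      forall j, (0 < j <= n)%N -> y' (0%N, j) = vinc x m j &
      forall i j, (n < j)%N -> y' (i, j) = x (i, j)].
Proof.
elim: n => [|n [h1 h2 h3]] /=.
  split=> //; first by case=> // i _; rewrite hincS0.
  by case.
rewrite foldl_cat; set z := foldl _ _ _ in h1 h2 h3 *.
have [g1 _ g3 _ g5] := @burke_row x z m n m (leqnn _) h1 (h3 _ _ (ltnSn _))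
  (fun i _ => h3 _ _ (ltnSn _)).
split=> //.
- move=> j /andP[j0]; rewrite leq_eqVlt => /orP[/eqP->//|jn].
  have jn1 : j != n.+1 by rewrite ltn_eqF.
  by rewrite g5 -?lt0n// h2// j0 -ltnS.
- move=> i j nj; have jn1 : j != n.+1 by rewrite gtn_eqF.
  by rewrite g5 -?lt0n ?(leq_trans _ nj)// h3// ltnW.
Qed.

Context {d : measure_display} {T : measurableType d}.
Variable P : probability T R.

(** The vertical rates may depend on the row; the weights of row j have rate
    a + b j. A row with its own rate serves to measure waiting times. *)
Lemma indep_law_burke_run (cells : seq site) (mu : site -> set R -> \bar R)
    (X : site -> T -> R) (a : R) (b : nat -> R) :
  0 < a -> (forall j, 0 < b j) ->
  indep_law P X mu ->
  (forall c, c \in cells -> [/\ (0 < c.1)%N, (0 < c.2)%N, is_exp a (mu (c.1, 0%N)),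
     is_exp (b c.2) (mu (0%N, c.2)) & is_exp (a + b c.2) (mu c)]) ->
  indep_law P (fun p t => foldl burke_step (fun q => X q t) cells p) mu.
Proof.
move=> a0 b0; elim: cells X => [|c cells IH] X indX cP //=.
have [c1 c2 la lb lab] := cP c (mem_head _ _).
apply: (IH (fun p t => burke_step (fun q => X q t) c p)); last first.
  by move=> c' c's; apply: cP; rewrite inE c's orbT.
have n1 : (c.1, 0%N) != (0%N, c.2) :> site by rewrite xpair_eqE (gtn_eqF c1).
have n2 : (c.1, 0%N) != c.
  by rewrite [c]surjective_pairing xpair_eqE eqxx eq_sym (gtn_eqF c2).
have n3 : (0%N, c.2) != c.
  by rewrite [c]surjective_pairing xpair_eqE eqxx eq_sym (gtn_eqF c1).
have := burke_cell indX a0 (b0 c.2) n1 n2 n3 la lb lab.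
rewrite (_ : (fun k => _) = (fun p t => burke_step (fun q => X q t) c p))//.
apply/funext => p; apply/funext => t; rewrite /burke_step.
by do 3 case: (p == _).
Qed.

End BurkeRun.

Section MomentIdentity.
Context {d : measure_display} {T : measurableType d} {R : realType}.
Local Notation Exp a := (exponential_prob (a : R)).

Lemma measurable_lastpass (X : site -> T -> R) i j :
  (forall p, measurable_fun setT (X p)) ->
  measurable_fun setT (fun t => lastpass (fun p => X p t) i j).
Proof.
move=> mX; move: i j; apply: grid_ind => [|i IH|j IH|i j IH1 IH2].
- apply: eq_measurable_fun (mX (0, 0)%N) => t _; by rewrite lpE.
- apply: (eq_measurable_fun (X (i.+1, 0)%N \+ (fun t => lastpass (fun p => X p t) i 0))).
    by move=> t _; rewrite lpE.
  exact: measurable_funD.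
- apply: (eq_measurable_fun (X (0, j.+1)%N \+ (fun t => lastpass (fun p => X p t) 0 j))).
    by move=> t _; rewrite lpE.
  exact: measurable_funD.
- apply: (eq_measurable_fun (X (i.+1, j.+1) \+ (fun t => Num.max
    (lastpass (fun p => X p t) i j.+1) (lastpass (fun p => X p t) i.+1 j)))).
    by move=> t _; rewrite lpE.
  by apply: measurable_funD => //; exact: measurable_maxr.
Qed.

(** The model is stationary if w = z. *)
Definition boundary_law (w z : R) (mu : site -> set R -> \bar R) : Prop :=
  [/\ forall i, is_exp w (mu (i.+1, 0%N)),
      forall j, is_exp (1 - z) (mu (0%N, j.+1)) &
      forall i j, is_exp 1 (mu (i.+1, j.+1))].

Definition pin (x : site -> R) : site -> R := fun p => if p == (0, 0)%N then 0 else x p.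

Lemma vinc_pin x m j : vinc (pin x) m j.+1 = vinc x m j.+1.
Proof.
rewrite /vinc /=.
have E i l : lastpass x i l = x (0, 0)%N + lastpass (pin x) i l.
  move: i l; apply: grid_ind => [|i IH|j' IH|i j' IH1 IH2]; rewrite !lpE /pin /=.
  - by rewrite addr0.
  - by rewrite IH addrCA.
  - by rewrite IH addrCA.
  - by rewrite IH1 IH2 -addr_maxr addrCA.
by rewrite !E opprD addrACA subrr add0r.
Qed.

(** The passage time is the sum of the bottom weights and of the increments along
    the east side. The factor exp ((w - z) * bottom weights) tilts the rate of
    the bottom from w to z; the tilted model is stationary, so that the increments
    along the east side are independent of rate 1 - z. *)
Lemma lastpass_mgf (P : probability T R) (X : site -> T -> R) mu (w z : R) (m n : nat) :
  indep_law P X mu -> 0 < w < 1 -> 0 < z < 1 -> boundary_law w z mu ->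
  (\int[P]_t (expR ((w - z) * lastpass (pin (fun p => X p t)) m n))%:E =
   ((w / z) ^+ m * ((1 - z) / (1 - w)) ^+ n)%:E)%E.
Proof.
move=> indX /andP[w0 w1] /andP[z0 z1] [lw lz l1].
have wz : w - z < w by rewrite ltrBlDr ltrDl.
pose s : seq site := [seq (l, 0%N) | l <- index_iota 1 m.+1].
have us : uniq s.
  by rewrite map_inj_uniq ?iota_uniq// => k l [].
have sE k : k \in s -> is_exp w (mu k).
  by case/mapP => -[|l]; rewrite mem_index_iota// => _ ->.
have mX := indX.1.
have [P' [ind' PH]] := indep_law_tilt_seq indX w0 wz us sE.
pose H t := expR ((w - z) * \sum_(1 <= l < n.+1) vinc (fun p => X p t) m l).
have mV l : measurable_fun setT (fun t => vinc (fun p => X p t) m l).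
  by apply: measurable_funB; exact: measurable_lastpass.
have mH : measurable_fun setT H.
  apply: measurableT_comp => //; apply: measurable_funM => //.
  exact: measurable_sum.
transitivity (\int[P]_t ((expR ((w - z) * \sum_(k <- s) X k t))%:E * (H t)%:E))%E.
  apply: eq_integral => t _; rewrite -EFinM /H -expRD -mulrDr.
  have bottom : \sum_(1 <= l < m.+1) pin (fun p => X p t) (l, 0%N) = \sum_(k <- s) X k t.
    by rewrite big_map; apply: eq_big_nat => -[].
  have east : \sum_(1 <= l < n.+1) vinc (pin (fun p => X p t)) m l =
      \sum_(1 <= l < n.+1) vinc (fun p => X p t) m l.
    by apply: eq_big_nat => -[|l] // _; exact: vinc_pin.
  rewrite lastpass_vinc lastpass_row0 bottom east.
  by have -> : pin (fun p => X p t) (0, 0)%N = 0 by []; rewrite add0r.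
rewrite PH//; last 2 first.
- by apply/measurable_EFinP.
- by move=> t; rewrite lee_fin expR_ge0.
have wzz : w - (w - z) = z by rewrite subKr.
rewrite wzz size_map size_iota subSS subn0 EFinM; congr (_ * _)%E.
pose cells := grid_cells m n.
pose Y p t := foldl burke_step (fun q => X q t) cells p.
have b0 (j : nat) : 0 < 1 - z by rewrite subr_gt0.
rewrite wzz in ind'.
have indY : indep_law P' Y (fun k => if k \in s then Exp z else mu k).
  apply: (@indep_law_burke_run _ _ _ _ cells _ X z (fun=> 1 - z)) => //.
  move=> [[|i] [|j]] /mem_grid_cells[]//= _ im _ jn.
  have ns k : (k, j.+1) \notin s by apply/mapP => -[].
  split=> //.
  - by rewrite ifT//; apply/mapP; exists i.+1; rewrite ?mem_index_iota.
  - by rewrite (negbTE (ns _)).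
  - by rewrite (negbTE (ns _)) addrC subrK.
pose s2 : seq site := [seq (0%N, l) | l <- index_iota 1 n.+1].
have us2 : uniq s2 by rewrite map_inj_uniq ?iota_uniq// => k l [].
have s2E k : k \in s2 -> is_exp (1 - z) (if k \in s then Exp z else mu k).
  case/mapP => -[|l]; rewrite mem_index_iota// => _ ->.
  by rewrite ifF//; apply/negbTE/mapP => -[].
have wz2 : w - z < 1 - z by rewrite ltrD2r.
have E : 1 - z - (w - z) = 1 - w by ring.
have := integral_exp_sum indY (b0 0%N) wz2 us2 s2E.
rewrite E size_map size_iota subSS subn0 => <-.
apply: eq_integral => t _; rewrite /H big_map; congr (expR (_ * _))%:E.
apply: eq_big_nat => l ln.
by have [_ g2 _] := burke_grid (fun q => X q t) m n; rewrite -g2.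
Qed.

End MomentIdentity.

(** * Tails of passage times with two boundaries *)

Section Potential.
Context {R : realType}.
Implicit Types (u w z g zeta : R) (m n : nat).

(** Logarithm of the moment generating function in [lastpass_mgf]: a difference of
    two values of the potential. Its derivative, the slope, is the mean passage
    time of the stationary model of parameter u. *)
Definition potential m n u : R := m%:R * ln u - n%:R * ln (1 - u).
Definition slope m n u : R := m%:R / u + n%:R / (1 - u).

Lemma expR_potential m n w z : 0 < w < 1 -> 0 < z < 1 ->
  (w / z) ^+ m * ((1 - z) / (1 - w)) ^+ n = expR (potential m n w - potential m n z).
Proof.
move=> /andP[w0 w1] /andP[z0 z1].
have w1' : 0 < 1 - w by rewrite subr_gt0.
have z1' : 0 < 1 - z by rewrite subr_gt0.
have quot x y : 0 < x -> 0 < y -> x / y = expR (ln x - ln y).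
  by move=> x0 y0; rewrite expRB !lnK.
rewrite !quot// -!expRM_natl -expRD /potential; congr expR; ring.
Qed.

Lemma potential_mvt m n z w : 0 < z -> z < w -> w < 1 ->
  exists2 u, z < u < w & potential m n w - potential m n z = (w - z) * slope m n u.
Proof.
move=> z0 zw w1.
have d u : 0 < u -> u < 1 -> is_derive u 1 (potential m n) (slope m n u).
  move=> u0 u1; have u1' : 0 < 1 - u by rewrite subr_gt0.
  have d1 := is_derive1_ln u0.
  have d2 : is_derive u 1 (fun x : R => 1 - x) (- 1).
    by apply: is_derive_eq; rewrite add0r mul1r.
  have d3 := @is_derive1_comp R (@ln R) (fun x : R => 1 - x) u _ _ (is_derive1_ln u1') d2.
  have d4 : is_derive u 1 ((m%:R *: (@ln R : R -> R)) - (n%:R *: (@ln R \o (fun x : R => 1 - x))))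
     (m%:R *: u^-1 - n%:R *: ((1 - u)^-1 * -1)) by exact: is_deriveB.
  rewrite (_ : slope m n u = m%:R *: u^-1 - n%:R *: ((1 - u)^-1 * -1)) //.
  by rewrite /slope /GRing.scale /= mulrN1 mulrN opprK.
have zw_in u : u \in `[z, w] -> 0 < u /\ u < 1.
  rewrite in_itv /= => /andP[zu uw].
  by rewrite (lt_le_trans z0 zu) (le_lt_trans uw w1).
have dd u : u \in `]z, w[ -> is_derive u 1 (potential m n) (slope m n u).
  move=> uzw; have [u0 u1] := zw_in u (subset_itv_oo_cc uzw); exact: d.
have c : {within `[z, w], continuous (potential m n)}.
  apply: derivable_within_continuous => u /zw_in[u0 u1].
  by have := d u u0 u1 => -[].
have [u uzw] := MVT zw dd c.
rewrite mulrC => ->; exists u => //; by rewrite in_itv in uzw.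
Qed.

(** The mean of the stationary model is minimal in the characteristic direction
    zeta, where it equals the value g of the shape function, and is explicit and
    quadratic around it. *)
Lemma slope_eq m n g zeta u : 0 < u < 1 ->
  m%:R = g * zeta ^+ 2 -> n%:R = g * (1 - zeta) ^+ 2 ->
  slope m n u = g + g * (u - zeta) ^+ 2 / (u * (1 - u)).
Proof.
move=> /andP[u0 u1] mE nE; rewrite /slope mE nE.
by field; rewrite ?subr_eq0 ?(gt_eqF u1) ?(gt_eqF u0)//.
Qed.

Lemma potential_ge m n z w B : 0 < z -> z < w -> w < 1 ->
  (forall u, z < u < w -> B <= slope m n u) ->
  (w - z) * B <= potential m n w - potential m n z.
Proof.
move=> z0 zw w1 H; have [u uzw ->] := potential_mvt m n z0 zw w1.
by rewrite ler_pM2l ?subr_gt0// H.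
Qed.

Lemma potential_le m n z w B : 0 < z -> z < w -> w < 1 ->
  (forall u, z < u < w -> slope m n u <= B) ->
  potential m n w - potential m n z <= (w - z) * B.
Proof.
move=> z0 zw w1 H; have [u uzw ->] := potential_mvt m n z0 zw w1.
by rewrite ler_pM2l ?subr_gt0// H.
Qed.

Section SlopeBounds.
Variables (m n : nat) (g zeta : R).
Hypotheses (g0 : 0 <= g) (mE : m%:R = g * zeta ^+ 2) (nE : n%:R = g * (1 - zeta) ^+ 2).

Lemma slope_ge u : 0 < u < 1 -> g * (1 + 4 * (u - zeta) ^+ 2) <= slope m n u.
Proof.
move=> u01; rewrite (slope_eq u01 mE nE) (mulrDr g 1) mulr1 lerD2l -mulrA.
apply: ler_wpM2l => //; have /andP[u0 u1] := u01.
rewrite ler_pdivlMr ?mulr_gt0 ?subr_gt0// mulrAC ler_piMl ?sqr_ge0//.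
rewrite -subr_ge0 (_ : _ - _ = (1 - 2 * u) ^+ 2) ?sqr_ge0//; ring.
Qed.

Lemma slope_le c D u : 0 < c -> 2 * c <= 1 -> c <= u -> u <= 1 - c ->
  (u - zeta) ^+ 2 <= D -> slope m n u <= g * (1 + 2 / c * D).
Proof.
move=> c0 c2 cu uc uD.
have u0 : 0 < u by exact: lt_le_trans cu.
have u1 : u < 1 by lra.
rewrite (@slope_eq m n g zeta) ?u0// (mulrDr g 1) mulr1 lerD2l -mulrA.
apply: ler_wpM2l => //; rewrite mulrC; apply: ler_pM => //.
- by rewrite invr_ge0 mulr_ge0 ?subr_ge0 ?(ltW u0) ?(ltW u1).
- exact: sqr_ge0.
have -> : 2 / c = (c / 2)^-1 by rewrite invf_div.
rewrite lef_pV2 ?posrE ?divr_gt0 ?mulr_gt0 ?subr_gt0//.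
have : 0 <= (u - c) * (1 - c - u) by rewrite mulr_ge0// ?subr_ge0//; lra.
nra.
Qed.

End SlopeBounds.
End Potential.

Section Tails.
Context {d : measure_display} {T : measurableType d} {R : realType}.
Variables (P : probability T R) (X : site -> T -> R) (mu : site -> set R -> \bar R).
Variables (w z : R) (m n : nat).
Hypotheses (indX : indep_law P X mu) (w01 : 0 < w < 1) (z01 : 0 < z < 1).
Hypothesis (bl : boundary_law w z mu).

Let Z t := lastpass (pin (fun p => X p t)) m n.

Lemma measurable_lastpass_pin : measurable_fun setT Z.
Proof.
apply: (@measurable_lastpass _ _ _ (fun p t => pin (fun q => X q t) p)) => p.
rewrite /pin; case: (p == _); [exact: measurable_cst|exact: (indX.1 p)].
Qed.

Let mgf : (\int[P]_t (expR ((w - z) * Z t))%:E =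
  (expR (potential m n w - potential m n z))%:E)%E.
Proof. by rewrite -expR_potential//; exact: (lastpass_mgf m n indX w01 z01 bl). Qed.

Lemma lastpass_upper_tail b : z < w ->
  (P [set t | (b <= lastpass (pin (fun p => X p t)) m n)%R] <=
   (expR (potential m n w - potential m n z - (w - z) * b))%:E)%E.
Proof.
move=> zw; have := chernoff b measurable_lastpass_pin mgf; rewrite -expRD.
rewrite (_ : [set t | _] = [set t | b <= Z t])//; apply/seteqP.
by split=> t /=; rewrite ler_pM2l// subr_gt0.
Qed.

Lemma lastpass_lower_tail b : w < z ->
  (P [set t | (lastpass (pin (fun p => X p t)) m n <= b)%R] <=
   (expR ((z - w) * b - (potential m n z - potential m n w)))%:E)%E.
Proof.
move=> wz; have := chernoff b measurable_lastpass_pin mgf; rewrite -expRD.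
rewrite (_ : [set t | _] = [set t | Z t <= b]); last first.
  by apply/seteqP; split=> t /=; rewrite ler_nM2l// subr_lt0.
move=> /le_trans; apply; rewrite lee_fin ler_expR.
by rewrite -mulNr !opprB addrC.
Qed.

End Tails.

(** * Boundary models around a rectangle *)

Section Geometry.
Context {R : realType}.
Implicit Types (x y : site -> R) (i j k m n : nat).

Lemma lastpass_top y k m n : (0 < k <= m)%N ->
  lastpass y k n + \sum_(k <= l < m.+1) y (l, n.+1) <= lastpass y m n.+1.
Proof.
move=> /andP[k0 km]; rewrite -(subnKC km); elim: (m - k)%N => [|l IH].
  by rewrite addn0 big_nat1 addrC lastpass_stepr.
rewrite addnS big_nat_recr/=; last by rewrite -addnS leq_addr.
rewrite addrA; apply: le_trans (lastpass_stepl _ _ _).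
by rewrite addrC lerD2l.
Qed.

(** A path that ends in the row above n entered that row at some column k; the
    hypothesis excludes the column 0. *)
Lemma lastpass_row_exit y m n : lastpass y 0 n.+1 <= lastpass y 1 n ->
  exists2 k, (0 < k <= m.+1)%N &
  lastpass y m.+1 n.+1 <= lastpass y k n + \sum_(k <= l < m.+2) y (l, n.+1).
Proof.
move=> y0; elim: m => [|m [k /andP[k0 km] IH]].
  by exists 1%N => //; rewrite big_nat1 lpE addrC lerD2r ge_max y0 lexx.
rewrite lpE; have [le|le] := leP (lastpass y m.+1 n.+1) (lastpass y m.+2 n).
  by exists m.+2; rewrite ?ltnSn// big_nat1 addrC.
exists k; rewrite ?k0 ?(leqW km)//.
by rewrite big_nat_recr ?(leqW km)//= [in leRHS]addrA (addrC (y _)) lerD2r.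
Qed.

Definition transpose (p : site) : site := (p.2, p.1).

Lemma lastpass_transpose x i j :
  lastpass (fun p => x (transpose p)) j i = lastpass x i j.
Proof.
move: i j; apply: grid_ind => [|i IH|j IH|i j IH1 IH2]; rewrite !lpE ?IH//.
by rewrite IH1 IH2 maxC.
Qed.

Lemma lastpass_col_exit y m n : lastpass y m.+1 0 <= lastpass y m 1 ->
  exists2 k, (0 < k <= n.+1)%N &
  lastpass y m.+1 n.+1 <= lastpass y m k + \sum_(k <= l < n.+2) y (m.+1, l).
Proof.
rewrite -!(lastpass_transpose y) => /lastpass_row_exit -/(_ n)[k k0 H].
by exists k; rewrite // -(lastpass_transpose y).
Qed.

(** The end point may be moved to the corner of a margin without weights. *)
Lemma lastpass_margin y m n : (forall p, 0 <= y p) ->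
  (forall j, (j <= n.+1)%N -> y (m.+1, j) = 0) ->
  (forall i, (i <= m.+1)%N -> y (i, n.+1) = 0) ->
  lastpass y m.+1 n.+1 = lastpass y m n.
Proof.
move=> y0 ym yn; apply/le_anti/andP; split; last exact: lastpass_mono.
have col j : (j <= n)%N -> lastpass y m.+1 j <= lastpass y m j.
  elim: j => [|j IH] jn; first by rewrite lpE ym// add0r.
  rewrite lpE ym ?(leqW jn)// add0r ge_max lexx /=.
  by apply: le_trans (IH (ltnW jn)) _; exact: lastpass_mono.
have row i : (i <= m)%N -> lastpass y i n.+1 <= lastpass y i n.
  elim: i => [|i IH] im; first by rewrite lpE yn// add0r.
  rewrite lpE yn ?(leqW im)// add0r ge_max lexx andbT.
  by apply: le_trans (IH (ltnW im)) _; exact: lastpass_mono.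
by rewrite lpE ym// add0r ge_max col// row.
Qed.

Definition rate (w z : R) (p : site) : R :=
  if p.2 == 0%N then w else if p.1 == 0%N then 1 - z else 1.

(** The bulk is the rectangle with corners (1, 1) and (m, n). Its north and east
    sides carry boundary weights of rates w and 1 - z, the axes and the corner
    (m + 1, n + 1) no weight. *)
Definition ne_field m n (w z : R) x : site -> R := fun p =>
  if (p.1 == 0%N) || (p.2 == 0%N) then 0
  else if (p.1 <= m)%N then
    if (p.2 <= n)%N then x p else if p.2 == n.+1 then x p / w else 0
  else if (p.1 == m.+1) && (p.2 <= n)%N then x p / (1 - z) else 0.

(** Extended by the identity outside the rectangle to be injective. *)
Definition grid_flip m n (p : site) : site :=
  if (p.1 <= m)%N && (p.2 <= n)%N then flip m n p else p.

Lemma grid_flip_inj m n : injective (grid_flip m n).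
Proof.
apply: (can_inj (g := grid_flip m n)) => -[a b]; rewrite /grid_flip /flip /=.
case: (boolP ((a <= m)%N && (b <= n)%N)) => [/andP[am bn]|/negbTE abmn] /=.
  by rewrite !leq_subr /= !subKn.
by rewrite abmn.
Qed.

Section NorthEast.
Variables (m n : nat) (w z : R) (x : site -> R).
Hypotheses (w0 : 0 < w) (z1 : z < 1) (x0 : forall p, 0 <= x p).

Lemma ne_field_ge0 p : 0 <= ne_field m n w z x p.
Proof.
have z1' : 0 <= 1 - z by rewrite subr_ge0 ltW.
have w0' := ltW w0.
by rewrite /ne_field; do 5?[case: ifP => // _]; rewrite divr_ge0.
Qed.

(** By reversal of paths the boundaries on the north and east sides become
    boundaries on the axes, to which the moment identity applies. *)
Lemma lastpass_ne_field :
  lastpass (ne_field m n w z x) m.+1 n.+1 =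
  lastpass (pin (fun p => x (grid_flip m.+1 n.+1 p) / rate w z p)) m n.
Proof.
rewrite -lastpass_flip lastpass_margin.
- apply: eq_lastpass => a b am bn.
  rewrite /ne_field /pin /grid_flip /rate /= !(leqW am) !(leqW bn) /flip /=.
  case: a am => [|a] am; case: b bn => [|b] bn; rewrite ?subn0 ?subSS /= ?ltnn ?eqxx ?andbF //=.
  + by rewrite leq_subr subn_eq0 leqNgt bn.
  + by rewrite leq_subr subn_eq0 leqNgt am /= ?ltnn ?eqxx.
  + have -> : (m - a == 0)%N = false by rewrite subn_eq0 leqNgt am.
    have -> : (n - b == 0)%N = false by rewrite subn_eq0 leqNgt bn.
    by rewrite (leq_subr a m) (leq_subr b n) divr1.
- by move=> p; exact: ne_field_ge0.
- by move=> j _; rewrite /ne_field /flip /= subnn.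
- by move=> i _; rewrite /ne_field /flip /= subnn orbT.
Qed.

Lemma lastpass_ne_bulk i j : (i <= m)%N -> (j <= n)%N ->
  lastpass (ne_field m n w z x) i j = lastpass (bulk x) i j.
Proof.
move=> im jn; apply: eq_lastpass => a b ai bj.
rewrite /ne_field /bulk /no_bottom /no_left /= (leq_trans ai)// (leq_trans bj)//.
by case: (a == 0%N); case: (b == 0%N).
Qed.

Lemma top_exit_le k : (0 < k <= m)%N ->
  lastpass (bulk x) k n + \sum_(k <= l < m.+1) x (l, n.+1) / w <=
  lastpass (ne_field m n w z x) m.+1 n.+1.
Proof.
move=> k0m; have /andP[k0 km] := k0m.
apply: (@le_trans _ _ (lastpass (ne_field m n w z x) m n.+1)); last first.
  exact: (lastpass_mono ne_field_ge0).
rewrite -lastpass_ne_bulk//; apply: le_trans (lastpass_top _ _ k0m).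
rewrite lerD2l big_nat [leRHS]big_nat; apply: ler_sum => l /andP[kl lm].
have l0 : (0 < l)%N by exact: leq_trans kl.
by rewrite /ne_field /= (gtn_eqF l0) -ltnS lm ltnn eqxx.
Qed.

Lemma ne_exit : (0 < m)%N -> (0 < n)%N ->
  (exists2 k, (0 < k <= m)%N & lastpass (ne_field m n w z x) m.+1 n.+1 <=
     lastpass (bulk x) k n + \sum_(k <= l < m.+1) x (l, n.+1) / w) \/
  (exists2 k, (0 < k <= n)%N & lastpass (ne_field m n w z x) m.+1 n.+1 <=
     lastpass (bulk x) m k + \sum_(k <= l < n.+1) x (m.+1, l) / (1 - z)).
Proof.
move=> m0 n0; set y := ne_field m n w z x.
have y0 := ne_field_ge0.
have yc0 j : lastpass y 0 j = 0.
  by elim: j => [|j IH]; rewrite lpE ?IH ?addr0// /y /ne_field /=.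
have yr0 i : lastpass y i 0 = 0.
  by elim: i => [|i IH]; rewrite lpE ?IH ?addr0// /y /ne_field /=.
have corner : y (m.+1, n.+1) = 0 by rewrite /y /ne_field /= !ltnn andbF.
rewrite lpE corner add0r.
have [le|le] := leP (lastpass y m n.+1) (lastpass y m.+1 n); [right|left].
  have [k /andP[k0 kn] H] := @lastpass_col_exit y m n.-1 ltac:(by rewrite yr0 (lastpass_ge0 y0)).
  rewrite prednK// in kn H.
  exists k; first by rewrite k0.
  apply: le_trans H _; rewrite lastpass_ne_bulk// lerD2l.
  rewrite big_nat [leRHS]big_nat; apply: ler_sum => l /andP[kl lm].
  have l0 : (0 < l)%N by exact: leq_trans kl.
  by rewrite /y /ne_field /= (gtn_eqF l0) ltnn eqxx -ltnS lm.
have [k /andP[k0 kn] H] := @lastpass_row_exit y m.-1 n ltac:(by rewrite yc0 (lastpass_ge0 y0)).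
rewrite prednK// in kn H.
exists k; first by rewrite k0.
apply: le_trans H _; rewrite lastpass_ne_bulk// lerD2l.
rewrite big_nat [leRHS]big_nat; apply: ler_sum => l /andP[kl lm].
have l0 : (0 < l)%N by exact: leq_trans kl.
by rewrite /y /ne_field /= (gtn_eqF l0) -ltnS lm ltnn eqxx.
Qed.

End NorthEast.

(** Below row n + 1 this is the stationary model of parameter z. The row n + 1 has
    weights of rate z + e and starts with a vertical increment of rate e: fed with
    the stationary increments of rate z, it is stationary as well. *)
Definition stack_rate n (z e : R) (p : site) : R :=
  if p.2 == 0%N then z
  else if p.1 == 0%N then (if p.2 == n.+1 then e else 1 - z)
  else if p.2 == n.+1 then z + e else 1.

(** Following row n to column k and then row n + 1 gives a lower bound for the
    passage time of the stacked model, which exceeds the one of the stationary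
    model by a vertical increment. This bounds, for all k at once, the boundary
    sums minus the stationary increments; the latter are dominated by the bulk
    increments. *)
Lemma near_exit m n (z e : R) x k : 0 < z < 1 -> 0 < e -> (forall p, 0 <= x p) ->
  let gz := pin (fun p => x p / rate z z p) in
  lastpass (no_left gz) m n <= lastpass (no_bottom gz) m n ->
  (0 < k <= m)%N ->
  lastpass (bulk x) k n + \sum_(k <= l < m.+1) x (l, n.+1) / (z + e) <=
  lastpass (bulk x) m n + vinc (fun p => x p / stack_rate n z e p) m n.+1.
Proof.
move=> /andP[z0 z1] e0 x0 gz le km; have /andP[k0 km'] := km.
have z1' : 0 < 1 - z by rewrite subr_gt0.
have r0 p : 0 <= rate z z p.
  by rewrite /rate; case: ifP => _; [exact: ltW|case: ifP => _; rewrite ?ltW].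
have gz0 p : 0 <= gz p by rewrite /gz /pin; case: ifP => // _; rewrite divr_ge0.
have gz00 : gz (0, 0)%N = 0 by [].
have := bulk_increment_ge gz0 gz00 km' le.
have bE i j : lastpass (bulk gz) i j = lastpass (bulk x) i j.
  apply: eq_lastpass => a b _ _; rewrite /bulk /no_bottom /no_left /gz /pin /rate /=.
  by rewrite xpair_eqE; case: (b == 0%N); case: (a == 0%N) => /=; rewrite ?divr1.
rewrite !bE => inc.
set st := fun p => x p / stack_rate n z e p.
have stE i : lastpass (pin st) i n = lastpass gz i n.
  apply: eq_lastpass => a b _ bn; rewrite /gz /pin /st /stack_rate /rate /=.
  by rewrite (ltn_eqF (bn : (b < n.+1)%N)).
have := lastpass_top (pin st) n km.
rewrite stE (eq_big_nat _ _ (F2 := fun l => x (l, n.+1) / (z + e))); last first.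
  move=> l /andP[kl _]; have l0 : (0 < l)%N by exact: leq_trans kl.
  by rewrite /pin /st /stack_rate /= xpair_eqE (gtn_eqF l0) eqxx.
have -> : lastpass (pin st) m n.+1 = lastpass gz m n + vinc st m n.+1.
  by rewrite -vinc_pin /vinc /= stE addrC subrK.
lra.
Qed.

(** Passage times through the bottom of rate w do not depend on the left boundary,
    and a model with a weaker left boundary shows that they are below the level b.
    The passage time above b is then due to the left boundary; the bottom of rate z
    is weaker than that of rate w. *)
Lemma left_ge_bottom m n (w w' z : R) x b : 0 < w' <= w -> w < z < 1 -> w' < 1 ->
  (forall p, 0 <= x p) ->
  b < lastpass (pin (fun p => x p / rate w z p)) m n ->
  lastpass (pin (fun p => x p / rate w w' p)) m n < b ->
  lastpass (no_left (pin (fun p => x p / rate z z p))) m n <=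
  lastpass (no_bottom (pin (fun p => x p / rate z z p))) m n.
Proof.
move=> /andP[w0' ww'] /andP[wz z1] w1 x0 lo hi.
set gz := pin (fun p => x p / rate z z p).
have w0 : 0 < w by exact: lt_le_trans ww'.
have z0 : 0 < z by exact: lt_trans wz.
have z1' : 0 < 1 - z by rewrite subr_gt0.
have w1' : 0 < 1 - w' by rewrite subr_gt0.
set h := pin (fun p => x p / rate w z p) in lo.
set h' := pin (fun p => x p / rate w w' p) in hi.
have h0 p : 0 <= h p.
  rewrite /h /pin; case: ifP => // _; rewrite divr_ge0// /rate.
  by case: ifP => _; [exact: ltW|case: ifP => _; rewrite ?ltW].
have h0' p : 0 <= h' p.
  rewrite /h' /pin; case: ifP => // _; rewrite divr_ge0// /rate.
  by case: ifP => _; [exact: ltW|case: ifP => _; rewrite ?ltW].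
have E1 : lastpass (no_bottom gz) m n = lastpass (no_bottom h) m n.
  apply: eq_lastpass => a c _ _; rewrite /no_bottom /gz /h /pin /rate /=.
  by case: (c == 0%N).
have E2 : lastpass (no_left h) m n = lastpass (no_left h') m n.
  apply: eq_lastpass => a c _ _; rewrite /no_left /h /h' /pin /rate /=.
  by case: (a == 0%N).
have L1 : lastpass (no_left gz) m n <= lastpass (no_left h) m n.
  apply: ler_lastpass => a c _ _; rewrite /no_left /gz /h /pin /rate /=.
  case: (a == 0%N) => //; case: ifP => // _; case: (c == 0%N) => //.
  by rewrite ler_wpM2l// lef_pV2 ?posrE// ltW.
have L2 : lastpass (no_left h') m n <= lastpass h' m n.
  by apply: ler_lastpass => a c _ _; rewrite /no_left; case: ifP.
rewrite (lastpass_max _ _ h0)// lt_max in lo.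
have lb : lastpass (no_left h) m n < b by rewrite E2; apply: le_lt_trans hi.
rewrite E1; apply: le_trans L1 (le_trans (ltW lb) _).
by case/orP: lo => [/(lt_trans lb)|/ltW//]; rewrite ltxx.
Qed.

End Geometry.

(** * Tails of the models built from one field *)

Section Rescale.
Context {d : measure_display} {T : measurableType d} {R : realType}.
Local Notation Exp a := (exponential_prob (a : R)).

Lemma exponential_prob_scale (a : R) (A : set R) : 0 < a -> measurable A ->
  Exp 1 [set x | A (x / a)] = Exp a A.
Proof.
move=> a0 mA; pose e1 : probability (measurableTypeR R) R := exponential_prob 1.
pose ea : probability (measurableTypeR R) R := exponential_prob a.
pose f (x : measurableTypeR R) : R := x / a.
have mf : measurable_fun setT f.
  have mid : measurable_fun setT (fun x : measurableTypeR R => x : R).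
    by move=> _ B mB; rewrite setTI.
  exact: measurable_funM.
pose i (x : measurableTypeR R) : R := x.
have mi : measurable_fun setT i by move=> _ B mB; rewrite setTI.
pose m1 : {measure set R -> \bar R} := pushforward (e1 ltr01) f.
pose m2 : {measure set R -> \bar R} := pushforward (ea a0) i.
rewrite -[LHS]/(m1 mf A) -[RHS]/(m2 mi A).
apply: eq_measure_half_lines; [|move=> r|exact: mA].
  rewrite -[m1 mf setT]/(Exp 1 setT) /exponential_prob integral_exponential_pdf//.
  by rewrite ltry.
rewrite -[LHS]/(Exp 1 [set x | (`]r, +oo[%classic : set R) (x / a)]).
rewrite -[RHS]/(Exp a `]r, +oo[%classic) Exp_half_line//.
rewrite (_ : [set x | _] = `](r * a), +oo[%classic); last first.
  by apply/seteqP; split => x /=; rewrite !in_itv /= !andbT ltr_pdivlMr.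
rewrite Exp_half_line//; congr (expR _)%:E.
have -> : Num.max (r * a) 0 = Num.max r 0 * a by rewrite maxr_pMl ?mul0r// ltW.
by ring.
Qed.

Lemma iid_rescale (P : probability T R) (X : site -> T -> R) (phi : site -> site)
    (r : site -> R) : indep_law P X (fun=> Exp 1) -> injective phi ->
  (forall k, 0 < r k) ->
  indep_law P (fun k t => X (phi k) t / r k) (fun k => Exp (r k)).
Proof.
move=> indX phiI r0.
have mdiv k : measurable_fun setT (fun x : R => x / r k) by exact: measurable_funM.
apply: indep_law_eq (indep_law_comp mdiv (indep_law_reindex phiI indX)) => k A mA.
exact: exponential_prob_scale.
Qed.

End Rescale.

Section Events.
Context {d : measure_display} {T : measurableType d} {R : realType}.
Local Notation Exp a := (exponential_prob (a : R)).
Variables (P : probability T R) (X : site -> T -> R).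
Hypothesis indX : indep_law P X (fun=> Exp 1).
Let x t : site -> R := fun p => X p t.

Lemma boundary_law_rate (w z : R) : boundary_law w z (fun p => Exp (rate w z p)).
Proof. by split=> [i|j|i j] A mA. Qed.

Lemma rate_gt0 (w z : R) p : 0 < w -> z < 1 -> 0 < rate w z p.
Proof.
by move=> w0 z1; rewrite /rate; case: ifP => // _; case: ifP; rewrite ?subr_gt0.
Qed.

Lemma sw_upper_tail (w z b : R) m n : 0 < z -> z < w -> w < 1 ->
  (P [set t | (b <= lastpass (pin (fun p => x t p / rate w z p)) m n)%R] <=
   (expR (potential m n w - potential m n z - (w - z) * b))%:E)%E.
Proof.
move=> z0 zw w1; have w0 := lt_trans z0 zw; have z1 := lt_trans zw w1.
have ind := iid_rescale indX (@inj_id _) (fun k => rate_gt0 k w0 z1).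
apply: (lastpass_upper_tail m n ind _ _ (boundary_law_rate w z) _ zw).
  by rewrite w0.
by rewrite z0.
Qed.

Lemma sw_lower_tail (w z b : R) m n : 0 < w -> w < z -> z < 1 ->
  (P [set t | (lastpass (pin (fun p => x t p / rate w z p)) m n <= b)%R] <=
   (expR ((z - w) * b - (potential m n z - potential m n w)))%:E)%E.
Proof.
move=> w0 wz z1; have z0 := lt_trans w0 wz; have w1 := lt_trans wz z1.
have ind := iid_rescale indX (@inj_id _) (fun k => rate_gt0 k w0 z1).
apply: (lastpass_lower_tail m n ind _ _ (boundary_law_rate w z) _ wz).
  by rewrite w0.
by rewrite z0.
Qed.

Hypothesis X0 : forall p t, 0 <= X p t.

Lemma ne_upper_tail (w z b : R) m n : 0 < z -> z < w -> w < 1 ->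
  (P [set t | (b <= lastpass (ne_field m n w z (x t)) m.+1 n.+1)%R] <=
   (expR (potential m n w - potential m n z - (w - z) * b))%:E)%E.
Proof.
move=> z0 zw w1; have w0 := lt_trans z0 zw; have z1 := lt_trans zw w1.
have ind := iid_rescale indX (@grid_flip_inj m.+1 n.+1) (fun k => rate_gt0 k w0 z1).
rewrite (_ : [set t | _] = [set t | b <= lastpass (pin (fun p =>
    x t (grid_flip m.+1 n.+1 p) / rate w z p)) m n]); last first.
  by apply/seteqP; split=> t /=; rewrite lastpass_ne_field// => p; exact: X0.
apply: (lastpass_upper_tail m n ind _ _ (boundary_law_rate w z) _ zw).
  by rewrite w0.
by rewrite z0.
Qed.

Lemma ne_lower_tail (w z b : R) m n : 0 < w -> w < z -> z < 1 ->
  (P [set t | (lastpass (ne_field m n w z (x t)) m.+1 n.+1 <= b)%R] <=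
   (expR ((z - w) * b - (potential m n z - potential m n w)))%:E)%E.
Proof.
move=> w0 wz z1; have z0 := lt_trans w0 wz; have w1 := lt_trans wz z1.
have ind := iid_rescale indX (@grid_flip_inj m.+1 n.+1) (fun k => rate_gt0 k w0 z1).
rewrite (_ : [set t | _] = [set t | lastpass (pin (fun p =>
    x t (grid_flip m.+1 n.+1 p) / rate w z p)) m n <= b]); last first.
  by apply/seteqP; split=> t /=; rewrite lastpass_ne_field// => p; exact: X0.
apply: (lastpass_lower_tail m n ind _ _ (boundary_law_rate w z) _ wz).
  by rewrite w0.
by rewrite z0.
Qed.

(** The stacked model is stationary, so the last vertical increment keeps the law
    of rate e of the first one. *)
Lemma stack_vinc_tail m n (z e b : R) : 0 < z < 1 -> 0 < e -> 0 <= b ->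
  P [set t | b < vinc (fun p => x t p / stack_rate n z e p) m n.+1] =
  (expR (- e * b))%:E.
Proof.
move=> /andP[z0 z1] e0 b0.
have r0 k : 0 < stack_rate n z e k.
  rewrite /stack_rate; case: ifP => // _; case: ifP => _; case: ifP => _ //.
    by rewrite subr_gt0.
  by rewrite addr_gt0.
have ind := iid_rescale indX (@inj_id _) r0.
pose rho (j : nat) := if j == n.+1 then e else 1 - z.
have rho0 j : 0 < rho j by rewrite /rho; case: ifP; rewrite ?subr_gt0.
pose cells := grid_cells m n.+1.
have := @indep_law_burke_run _ _ _ P cells _ _ z rho z0 rho0 ind.
have cP c : c \in cells -> [/\ (0 < c.1)%N, (0 < c.2)%N,
    is_exp z (Exp (stack_rate n z e (c.1, 0%N))),
    is_exp (rho c.2) (Exp (stack_rate n z e (0%N, c.2))) &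
    is_exp (z + rho c.2) (Exp (stack_rate n z e c))].
  case: c => [[|i] [|j]] /mem_grid_cells[] //= _ _ _ _.
  have -> : z + rho j.+1 = stack_rate n z e (i.+1, j.+1).
    by rewrite /stack_rate /rho /=; case: ifP => // _; rewrite addrC subrK.
  by split=> [||A mA|A mA|A mA].
move=> /(_ cP) => indY.
have mI : measurable (`]b, +oo[%classic : set R) by [].
have := indep_law_marginal (0%N, n.+1) indY mI.
rewrite {2}/stack_rate /= eqxx Exp_half_line// max_l// => <-.
congr (P _); apply/seteqP; split=> t /=;
  have [_ g2 _] := burke_grid (fun p => x t p / stack_rate n z e p) m n.+1;
  by rewrite in_itv /= andbT g2 ?ltnSn.
Qed.

(** Chernoff bound with theta = 1/2, as 2 <= e. *)
Lemma sum_upper_tail (s : seq site) (k : nat) : uniq s -> (size s <= k)%N ->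
  (P [set t | (4 * k%:R <= \sum_(p <- s) X p t)%R] <= (expR (- k%:R))%:E)%E.
Proof.
move=> us sk; have mX := indX.1.
have mS : measurable_fun setT (fun t => \sum_(p <- s) X p t) by exact: measurable_sum.
have h : (2^-1 : R) < 1 by lra.
have E := integral_exp_sum indX ltr01 h us (fun k _ A mA => erefl).
have := chernoff (4 * k%:R) mS E.
rewrite (_ : [set t | _] = [set t | 4 * k%:R <= \sum_(p <- s) X p t]); last first.
  by apply/seteqP; split=> t /=; rewrite ler_pM2l// invr_gt0.
move=> /le_trans; apply; rewrite lee_fin.
have -> : (1 : R) / (1 - 2^-1) = 2.
  by rewrite div1r (_ : 1 - 2^-1 = 2^-1) ?invrK//; lra.
have -> : 2^-1 * (4 * k%:R) = k%:R * 2 :> R by field.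
apply: (@le_trans _ _ (expR 1 ^+ k * expR (- (k%:R * 2)))).
  rewrite ler_wpM2r ?expR_ge0//; apply: (@le_trans _ _ (2 ^+ k)).
    by rewrite ler_weXn2l//; lra.
  apply: lerXn2r; rewrite ?nnegrE ?expR_ge0//.
  by have := expR_ge1Dx (1 : R); lra.
by rewrite -expRM_natl mulr1 -expRD ler_expR; lra.
Qed.

(** Chernoff bound with theta = -1, as exp (-1/2) >= 1/2. *)
Lemma sum_lower_tail (s : seq site) : uniq s ->
  (P [set t | (\sum_(p <- s) X p t <= (size s)%:R / 4)%R] <=
   (expR (- ((size s)%:R / 4)))%:E)%E.
Proof.
move=> us; have mX := indX.1; set k := size s.
have mS : measurable_fun setT (fun t => \sum_(p <- s) X p t) by exact: measurable_sum.
have h : (-1 : R) < 1 by lra.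
have E := integral_exp_sum indX ltr01 h us (fun k _ A mA => erefl).
have := chernoff (k%:R / 4) mS E.
rewrite (_ : [set t | _] = [set t | \sum_(p <- s) X p t <= k%:R / 4]); last first.
  by apply/seteqP; split=> t /=; rewrite !mulN1r lerN2.
move=> /le_trans; apply; rewrite lee_fin.
have -> : (1 : R) / (1 - -1) = 2^-1 by rewrite div1r; congr (_^-1); lra.
apply: (@le_trans _ _ (expR (- 2^-1) ^+ k * expR (- (-1 * (k%:R / 4))))).
  rewrite ler_wpM2r ?expR_ge0//.
  apply: lerXn2r; rewrite ?nnegrE ?expR_ge0 ?invr_ge0//.
  by have := expR_ge1Dx (- 2^-1 : R); lra.
by rewrite -expRM_natl -expRD ler_expR; lra.
Qed.

End Events.

(** * Rare events *)

Section BadEvents.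
Context {d : measure_display} {T : measurableType d} {R : realType}.
Variable P : probability T R.

Definition unlikely (e : R) (B : set T) : Prop := measurable B /\ (P B <= e%:E)%E.

Lemma unlikelyU (e1 e2 : R) (A B : set T) :
  unlikely e1 A -> unlikely e2 B -> unlikely (e1 + e2) (A `|` B).
Proof.
move=> [mA PA] [mB PB]; split; first exact: measurableU.
by apply: le_trans (measureU2 P mA mB) _; rewrite EFinD leeD.
Qed.

Lemma unlikelyW (e1 e2 : R) (B : set T) : e1 <= e2 -> unlikely e1 B -> unlikely e2 B.
Proof. by move=> e12 [mB PB]; split=> //; apply: le_trans PB _; rewrite lee_fin. Qed.

Lemma unlikely0 (e : R) : 0 <= e -> unlikely e set0.
Proof. by move=> e0; split=> //; rewrite measure0 lee_fin. Qed.

Lemma measurable_sublevel (f : T -> R) (b : R) : measurable_fun setT f ->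
  measurable [set t | f t <= b].
Proof.
move=> mf; rewrite (_ : [set t | _] = f @^-1` `]-oo, b]%classic).
  exact: measurable_preimageT.
by apply/seteqP; split=> t /=; rewrite in_itv.
Qed.

Lemma measurable_superlevel (f : T -> R) (b : R) : measurable_fun setT f ->
  measurable [set t | b <= f t].
Proof.
move=> mf; rewrite (_ : [set t | _] = f @^-1` `[b, +oo[%classic).
  exact: measurable_preimageT.
by apply/seteqP; split=> t /=; rewrite in_itv /= andbT.
Qed.

Lemma measurable_strict_superlevel (f : T -> R) (b : R) : measurable_fun setT f ->
  measurable [set t | b < f t].
Proof.
move=> mf; rewrite (_ : [set t | _] = f @^-1` `]b, +oo[%classic).
  exact: measurable_preimageT.
by apply/seteqP; split=> t /=; rewrite in_itv /= andbT.
Qed.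

End BadEvents.

(** g and zeta are the value of the shape function and the characteristic direction
    of (m, n), see [slope_eq]; c keeps all parameters within 4 eps of zeta away from
    0 and 1; C1 bounds the curvature of the mean around zeta. *)
Definition admissible {R : realType} (m n : nat) (g zeta c C1 eps : R) : Prop :=
  [/\ [/\ 0 < g, m%:R = g * zeta ^+ 2 & n%:R = g * (1 - zeta) ^+ 2],
      [/\ 0 < c, 4 * c <= 1, C1 * c = 2, 2 * c <= zeta & zeta <= 1 - 2 * c] &
      [/\ 0 < eps, 4 * eps <= c & 1 <= g * eps]].

Section TopBound.
Context {d : measure_display} {T : measurableType d} {R : realType}.
Local Notation Exp a := (exponential_prob (a : R)).
Variables (P : probability T R) (X : site -> T -> R).
Hypothesis indX : indep_law P X (fun=> Exp 1).
Hypothesis X0 : forall p t, 0 <= X p t.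
Let x t : site -> R := fun p => X p t.

Let mX p : measurable_fun setT (X p). Proof. exact: indX.1. Qed.

Let mXdiv p (r : R) : measurable_fun setT (fun t => X p t / r).
Proof. by apply: measurable_funM; [exact: mX|exact: measurable_cst]. Qed.

Lemma measurable_lastpass_pin_scale (r : site -> R) m n :
  measurable_fun setT (fun t => lastpass (pin (fun p => x t p / r p)) m n).
Proof.
apply: (@measurable_lastpass _ _ _ (fun p t => pin (fun q => X q t / r q) p)) => p.
by rewrite /pin; case: (p == _); [exact: measurable_cst|exact: mXdiv].
Qed.

Lemma measurable_lastpass_ne w z m n i j :
  measurable_fun setT (fun t => lastpass (ne_field m n w z (x t)) i j).
Proof.
apply: (@measurable_lastpass _ _ _ (fun p t => ne_field m n w z (x t) p)) => p.
rewrite /ne_field; case: (_ || _); first exact: measurable_cst.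
case: (_ <= _)%N.
  case: (_ <= _)%N; first exact: mX.
  by case: (_ == _); [exact: mXdiv|exact: measurable_cst].
by case: (_ && _); [exact: mXdiv|exact: measurable_cst].
Qed.

Lemma measurable_vinc_scale (r : site -> R) m n :
  measurable_fun setT (fun t => vinc (fun p => x t p / r p) m n).
Proof.
by apply: measurable_funB;
  apply: (@measurable_lastpass _ _ _ (fun p t => X p t / r p)) => p; exact: mXdiv.
Qed.

Lemma slope_le_near m n (g zeta c C1 eps r u : R) :
  admissible m n g zeta c C1 eps -> 0 <= r -> r <= 4 ->
  zeta - r * eps < u -> u < zeta + r * eps ->
  slope m n u <= g * (1 + C1 * (r ^+ 2 * eps ^+ 2)).
Proof.
move=> [[g0 mE nE] [c0 c4 C1c czeta zetac] [e0 ec ge1]] r0 r4 zu uz.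
have -> : C1 = 2 / c by rewrite -C1c mulfK// gt_eqF.
have re : r * eps <= c by apply: le_trans ec; rewrite ler_wpM2r// ltW.
apply: (slope_le (ltW g0) mE nE c0); [lra|lra|lra|].
have : 0 <= (r * eps - (u - zeta)) * (r * eps + (u - zeta)).
  by apply: mulr_ge0; lra.
lra.
Qed.

Variables (m n : nat) (g zeta c C1 eps : R).
Hypothesis adm : admissible m n g zeta c C1 eps.
Local Notation q := (g * eps ^+ 3).

Let q0 : 0 < q.
Proof. by have [[g0 _ _] _ [e0 _ _]] := adm; rewrite mulr_gt0// exprn_gt0. Qed.

Let C18 : 8 <= C1.
Proof.
have [_ [c0 c4 C1c _ _] _] := adm.
by rewrite -(ler_pM2r c0) C1c; lra.
Qed.

(** Two parameters below zeta, at distances 2 eps and 3 eps, where the mean is at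
    most g (1 + 9 C1 eps^2). *)
Lemma far_unlikely :
  unlikely P (expR (- (c * q)))
   [set t | g * (1 + 10 * C1 * eps ^+ 2) <=
     lastpass (ne_field m n (zeta - 2 * eps) (zeta - 3 * eps) (x t)) m.+1 n.+1].
Proof.
have [[g0 mE nE] [c0 c4 C1c czeta zetac] [e0 ec ge1]] := adm; have q0' := q0; have C18' := C18.
split; first exact/measurable_superlevel/measurable_lastpass_ne.
have z0 : 0 < zeta - 3 * eps by lra.
have zw : zeta - 3 * eps < zeta - 2 * eps by lra.
have w1 : zeta - 2 * eps < 1 by lra.
apply: le_trans (ne_upper_tail indX X0 _ m n z0 zw w1) _.
rewrite lee_fin ler_expR.
have := @potential_le _ m n _ _ (g * (1 + C1 * (3 ^+ 2 * eps ^+ 2))) z0 zw w1.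
have S u : zeta - 3 * eps < u < zeta - 2 * eps ->
    slope m n u <= g * (1 + C1 * (3 ^+ 2 * eps ^+ 2)).
  by move=> /andP[zu uw]; apply: (slope_le_near adm); lra.
move=> /(_ S).
have -> : zeta - 2 * eps - (zeta - 3 * eps) = eps by ring.
have E : eps * (g * (1 + C1 * (3 ^+ 2 * eps ^+ 2))) =
         eps * (g * (1 + 10 * C1 * eps ^+ 2)) - C1 * q by ring.
rewrite E; have : c * q <= C1 * q by rewrite ler_wpM2r ?(ltW q0)//; lra.
lra.
Qed.

(** For the parameters zeta + c eps and zeta + 2 eps the typical passage time is of
    order g (1 + t eps^2) with t > 3/2, while t is at most 1/2 when the left
    boundary is brought back to zeta. The level 3/2 separates the two, see
    [left_ge_bottom]. *)
Lemma vertical_unlikely :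
  unlikely P (expR (- (c * q)) + expR (- (c * q)))
   ([set t | lastpass (pin (fun p => x t p / rate (zeta + c * eps) (zeta + 2 * eps) p)) m n
       <= g * (1 + 3 / 2 * eps ^+ 2)] `|`
    [set t | g * (1 + 3 / 2 * eps ^+ 2) <=
       lastpass (pin (fun p => x t p / rate (zeta + c * eps) zeta p)) m n]).
Proof.
have [[g0 mE nE] [c0 c4 C1c czeta zetac] [e0 ec ge1]] := adm; have q0' := q0; have C18' := C18.
have ce : 0 < c * eps by rewrite mulr_gt0.
have ce2 : c * eps < eps by rewrite gtr_pMl//; lra.
apply: unlikelyU; split.
- exact/measurable_sublevel/measurable_lastpass_pin_scale.
- have w0 : 0 < zeta + c * eps by lra.
  have wz : zeta + c * eps < zeta + 2 * eps by lra.
  have z1 : zeta + 2 * eps < 1 by lra.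
  apply: le_trans (sw_lower_tail indX _ m n w0 wz z1) _.
  rewrite lee_fin ler_expR.
  have w1 : zeta + c * eps < zeta + eps by lra.
  have w2 : zeta + eps < zeta + 2 * eps by lra.
  have w3 : zeta + eps < 1 by lra.
  have w4 : 0 < zeta + eps by lra.
  have S u : 0 < u < 1 -> g * (1 + 4 * (u - zeta) ^+ 2) <= slope m n u.
    exact: (slope_ge (ltW g0) mE nE).
  have H1 := @potential_ge _ m n _ _ g w0 w1 w3.
  have {}H1 : (zeta + eps - (zeta + c * eps)) * g <=
      potential m n (zeta + eps) - potential m n (zeta + c * eps).
    apply: H1 => u /andP[wu uw]; apply: le_trans (S u _); last by apply/andP; split; lra.
    by rewrite ler_peMr ?(ltW g0)// lerDl mulr_ge0 ?sqr_ge0//; lra.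
  have H2 := @potential_ge _ m n _ _ (g * (1 + 4 * eps ^+ 2)) w4 w2 z1.
  have {}H2 : (zeta + 2 * eps - (zeta + eps)) * (g * (1 + 4 * eps ^+ 2)) <=
      potential m n (zeta + 2 * eps) - potential m n (zeta + eps).
    apply: H2 => u /andP[wu uw]; apply: le_trans (S u _); last by apply/andP; split; lra.
    rewrite ler_wpM2l ?(ltW g0)// lerD2l ler_wpM2l//.
    by rewrite ler_sqr ?nnegrE; lra.
  have E : (zeta + 2 * eps - (zeta + c * eps)) * (g * (1 + 3 / 2 * eps ^+ 2)) =
    (zeta + eps - (zeta + c * eps)) * g +
    (zeta + 2 * eps - (zeta + eps)) * (g * (1 + 4 * eps ^+ 2)) - (1 + 3 / 2 * c) * q.
    by field.
  rewrite E; have : c * q <= (1 + 3 / 2 * c) * q by rewrite ler_wpM2r ?(ltW q0)//; lra.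
  lra.
- exact/measurable_superlevel/measurable_lastpass_pin_scale.
- have z0 : 0 < zeta by lra.
  have zw : zeta < zeta + c * eps by lra.
  have w1 : zeta + c * eps < 1 by lra.
  apply: le_trans (sw_upper_tail indX _ m n z0 zw w1) _.
  rewrite lee_fin ler_expR.
  have H : potential m n (zeta + c * eps) - potential m n zeta <=
      (zeta + c * eps - zeta) * (g * (1 + C1 * (c ^+ 2 * eps ^+ 2))).
    by apply: potential_le => // u /andP[zu uw]; apply: (slope_le_near adm); lra.
  have E : (zeta + c * eps - zeta) * (g * (1 + C1 * (c ^+ 2 * eps ^+ 2))) =
    (zeta + c * eps - zeta) * (g * (1 + 3 / 2 * eps ^+ 2)) - c * q * (3 / 2 - C1 * c * c).
    by field.
  rewrite E C1c in H.
  have : c * q * 1 <= c * q * (3 / 2 - 2 * c).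
    by rewrite ler_wpM2l ?mulr_ge0 ?(ltW q0) ?(ltW c0)//; lra.
  lra.
Qed.

Lemma stack_unlikely :
  unlikely P (expR (- (c * q)))
   [set t | g * eps ^+ 2 <
     vinc (fun p => x t p / stack_rate n (zeta + 2 * eps) eps p) m n.+1].
Proof.
have [[g0 mE nE] [c0 c4 C1c czeta zetac] [e0 ec ge1]] := adm; have q0' := q0; have C18' := C18.
split; first exact/measurable_strict_superlevel/measurable_vinc_scale.
rewrite stack_vinc_tail//; last 2 first.
- by apply/andP; split; lra.
- by rewrite mulr_ge0 ?sqr_ge0 ?ltW.
rewrite lee_fin ler_expR.
have -> : - eps * (g * eps ^+ 2) = - q by ring.
rewrite lerN2 ler_piMl ?(ltW q0)//; lra.
Qed.

End TopBound.

(** * Exits from the bulk *)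

Lemma ler_sum_widen {R : realType} (F : nat -> R) a b n : (forall l, 0 <= F l) ->
  (a <= b <= n)%N -> \sum_(b <= l < n) F l <= \sum_(a <= l < n) F l.
Proof.
move=> F0 /andP[ab bn]; rewrite (big_cat_nat ab bn) /= lerDr.
by apply: sumr_ge0 => l _.
Qed.

(** The rates are at least c, so raising one by 4 eps costs at most 4 eps S / c^2. *)
Lemma near_cost {R : realType} (S k c C1 g eps w0 w1 : R) : 0 < c -> c <= w0 ->
  w1 = w0 + 4 * eps -> 0 <= eps -> 0 <= S -> S <= 4 * k -> k <= 45 * C1 * (g * eps) ->
  S / w0 <= S / w1 + 720 * C1 / c ^+ 2 * (g * eps ^+ 2).
Proof.
move=> c0 cw0 w1E e0 S0 Sk kC.
have w00 : 0 < w0 by lra.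
have w10 : 0 < w1 by lra.
have cw1 : c <= w1 by lra.
have -> : S / w0 = S / w1 + 4 * eps * (S * (w0 * w1)^-1).
  by rewrite w1E in w10 *; field; rewrite !gt_eqF.
rewrite lerD2l.
have -> : 720 * C1 / c ^+ 2 * (g * eps ^+ 2) =
    4 * eps * (180 * C1 * (g * eps) * (c ^+ 2)^-1) by ring.
apply: ler_wpM2l; first lra.
apply: ler_pM => //; [|lra|]; first by rewrite invr_ge0 mulr_ge0 ?ltW.
rewrite lef_pV2 ?posrE ?mulr_gt0 ?exprn_gt0// expr2.
by apply: ler_pM => //; exact: ltW.
Qed.

(** The rates are at most 1, so lowering one by eps gains at least eps S. *)
Lemma far_gain {R : realType} (S k C1 g eps w0 w2 : R) : 0 < w2 -> w0 = w2 + eps ->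
  w0 <= 1 -> 0 <= eps -> 0 <= C1 * (g * eps) -> k / 4 <= S -> 44 * C1 * (g * eps) <= k ->
  S / w0 + 11 * C1 * (g * eps ^+ 2) <= S / w2.
Proof.
move=> w20 w0E w01 e0 C0 Sk kC.
have w00 : 0 < w0 by lra.
have -> : S / w2 = S / w0 + eps * (S * (w0 * w2)^-1).
  by rewrite w0E in w00 *; field; rewrite !gt_eqF.
rewrite lerD2l.
have -> : 11 * C1 * (g * eps ^+ 2) = eps * (11 * C1 * (g * eps)) by ring.
apply: ler_wpM2l => //; rewrite -[leLHS]mulr1.
apply: ler_pM => //; [lra|lra|].
by rewrite invf_ge1 ?mulr_gt0// mulr_ile1 ?(ltW w00) ?(ltW w20)//; lra.
Qed.

Section TopBoundMain.
Context {d : measure_display} {T : measurableType d} {R : realType}.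
Local Notation Exp a := (exponential_prob (a : R)).
Variables (P : probability T R) (X : site -> T -> R).
Hypothesis indX : indep_law P X (fun=> Exp 1).
Hypothesis X0 : forall p t, 0 <= X p t.
Let x t : site -> R := fun p => X p t.

Variables (m n : nat) (g zeta c C1 eps : R).
Hypothesis adm : admissible m n g zeta c C1 eps.
Local Notation q := (g * eps ^+ 3).

(** A path leaves the bulk through the north side at column k, and K of order
    g eps separates two cases. If k is at least m - K, the boundary sum is
    compared with the stationary increments of parameter zeta + 2 eps by
    [near_exit]: the rates differ by 4 eps, which costs 4 eps K of order g eps^2.
    Otherwise the boundary sum has more than K terms, and replacing the rate
    zeta - eps by zeta - 2 eps would gain an amount of order eps K, beyond the upper tail of
    [far_unlikely]. *)
Lemma top_exit_bound : exists2 B : set T, unlikely P (6 * expR (- (c * q))) B &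
  forall t, ~ B t -> forall k, (0 < k <= m)%N ->
    lastpass (bulk (x t)) k n + \sum_(k <= l < m.+1) x t (l, n.+1) / (zeta - eps) <=
    Num.max (lastpass (bulk (x t)) m n + (1 + 720 * C1 / c ^+ 2) * (g * eps ^+ 2))
            (g - C1 * (g * eps ^+ 2)).
Proof.
have [[g0 mE nE] [c0 c4 C1c czeta zetac] [e0 ec ge1]] := adm.
have ce : 0 < c * eps by rewrite mulr_gt0.
have ce2 : c * eps <= eps by rewrite ler_piMl ?(ltW e0)//; lra.
have w0c : c <= zeta - eps by lra.
have w0le1 : zeta - eps <= 1 by lra.
have w2 : 0 < zeta - 2 * eps by lra.
have z1 : zeta - 3 * eps < 1 by lra.
have zz : 0 < zeta + 2 * eps < 1 by apply/andP; split; lra.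
have zw : 0 < zeta <= zeta + c * eps by apply/andP; split; lra.
have wz : zeta + c * eps < zeta + 2 * eps < 1 by apply/andP; split; lra.
have zeta1 : zeta < 1 by lra.
have q0 : 0 < q by rewrite mulr_gt0// exprn_gt0.
have C18 : 8 <= C1 by rewrite -(ler_pM2r c0) C1c; lra.
have geps0 : 0 < g * eps by rewrite mulr_gt0.
have y0 : 0 <= 44 * C1 * (g * eps) by rewrite mulr_ge0 ?(ltW geps0)//; lra.
pose K := (Num.truncn (44 * C1 * (g * eps))).+1.
have Klow : 44 * C1 * (g * eps) <= K%:R by apply/ltW/truncnS_gt.
have Kup : K%:R <= 45 * C1 * (g * eps).
  have h1 : K%:R <= 44 * C1 * (g * eps) + 1.
    by rewrite /K -natr1 lerD2r truncn_le.
  have h2 : 1 * 1 <= C1 * (g * eps) by apply: ler_pM => //; lra.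
  lra.
pose s : seq site := [seq (l, n.+1) | l <- index_iota (m.+1 - K) m.+1].
have us : uniq s by rewrite map_inj_uniq ?iota_uniq// => k l [].
have sK : (size s <= K)%N by rewrite size_map size_iota leq_subCl.
have sumE t : \sum_(p <- s) X p t = \sum_(m.+1 - K <= l < m.+1) x t (l, n.+1).
  by rewrite big_map.
have mS : measurable_fun setT (fun t => \sum_(p <- s) X p t).
  by apply: measurable_sum => p; exact: indX.1.
have cqge : c * q <= g * eps.
  have -> : c * q = g * eps * (c * eps ^+ 2) by ring.
  rewrite ler_piMr ?(ltW geps0)//.
  by rewrite mulr_ile1 ?sqr_ge0 ?(ltW c0)// ?exprn_ile1 ?(ltW e0)//; lra.
have KC : 8 * (g * eps) <= C1 * (g * eps) by rewrite ler_wpM2r// ltW.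
have U5 : unlikely P (expR (- (c * q))) [set t | 4 * K%:R <= \sum_(p <- s) X p t].
  apply: (@unlikelyW _ _ _ _ (expR (- K%:R))); first by rewrite ler_expR; lra.
  split; first exact: measurable_superlevel.
  exact: (sum_upper_tail indX us sK).
pose B2 := if (K <= m)%N then [set t | \sum_(p <- s) X p t <= K%:R / 4] else set0.
have U2 : unlikely P (expR (- (c * q))) B2.
  rewrite /B2; case: ifP => [Km|_]; last by apply: unlikely0; exact: expR_ge0.
  apply: (@unlikelyW _ _ _ _ (expR (- (K%:R / 4)))); first by rewrite ler_expR; lra.
  split; first exact: measurable_sublevel.
  have := sum_lower_tail indX us.
  by rewrite size_map size_iota subKn// (leq_trans Km).
have U1 := far_unlikely indX X0 adm.
have U3 := vertical_unlikely indX adm.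
have U4 := stack_unlikely indX adm.
have U := unlikelyU (unlikelyU (unlikelyU U1 U2) (unlikelyU U3 U4)) U5.
eexists; first apply: unlikelyW U; first lra.
move=> t /= nB k km; have /andP[k0 km'] := km.
have xt0 p : 0 <= x t p by exact: X0.
have far : lastpass (ne_field m n (zeta - 2 * eps) (zeta - 3 * eps) (x t)) m.+1 n.+1
    < g * (1 + 10 * C1 * eps ^+ 2).
  by rewrite ltNge; apply/negP => h; apply: nB; left; left; left.
have nB2 : ~ B2 t by move=> h; apply: nB; left; left; right.
have lo : g * (1 + 3 / 2 * eps ^+ 2) <
    lastpass (pin (fun p => x t p / rate (zeta + c * eps) (zeta + 2 * eps) p)) m n.
  by rewrite ltNge; apply/negP => h; apply: nB; left; right; left; left.
have hi : lastpass (pin (fun p => x t p / rate (zeta + c * eps) zeta p)) m n <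
    g * (1 + 3 / 2 * eps ^+ 2).
  by rewrite ltNge; apply/negP => h; apply: nB; left; right; left; right.
have stack : vinc (fun p => x t p / stack_rate n (zeta + 2 * eps) eps p) m n.+1 <=
    g * eps ^+ 2.
  by rewrite leNgt; apply/negP => h; apply: nB; left; right; right.
have sumhi : \sum_(m.+1 - K <= l < m.+1) x t (l, n.+1) < 4 * K%:R.
  by rewrite -sumE ltNge; apply/negP => h; apply: nB; right.
set S := \sum_(k <= l < m.+1) x t (l, n.+1).
have S0 : 0 <= S by apply: sumr_ge0 => l _.
have sumw w : \sum_(k <= l < m.+1) x t (l, n.+1) / w = S / w by rewrite mulr_suml.
rewrite sumw le_max.
have [near|nfar] := leqP (m.+1 - K) k; apply/orP; [left|right].
  have lb := left_ge_bottom zw wz zeta1 xt0 lo hi.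
  have := near_exit zz e0 xt0 lb km; rewrite sumw => H.
  have Sle : S <= 4 * K%:R.
    by apply: le_trans (ltW sumhi); apply: ler_sum_widen; rewrite // near leqW.
  have := @near_cost _ S K%:R c C1 g eps _ (zeta + 2 * eps + eps) c0 w0c _ (ltW e0) S0 Sle Kup.
  move=> /(_ ltac:(ring)).
  by clear - H stack; lra.
have Km : (K <= m)%N.
  by move: nfar; case: (leqP K m) => // mK; rewrite (eqP (_ : m.+1 - K == 0)%N)// subn_eq0.
have Sge : K%:R / 4 <= S.
  apply: le_trans (_ : \sum_(m.+1 - K <= l < m.+1) x t (l, n.+1) <= S).
    rewrite -sumE leNgt; apply/negP => h; apply: nB2.
    by rewrite /B2 Km; exact: ltW.
  by apply: ler_sum_widen; rewrite // (ltnW nfar) leq_subr.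
have := @top_exit_le R m n (zeta - 2 * eps) (zeta - 3 * eps) (x t) w2 z1 xt0 k km.
rewrite sumw => /le_lt_trans/(_ far) H.
have C1geps : 0 <= C1 * (g * eps) by apply: le_trans KC; rewrite mulr_ge0// ltW.
have := @far_gain _ S K%:R C1 g eps (zeta - eps) _ w2 _ w0le1 (ltW e0) C1geps Sge Klow.
move=> /(_ ltac:(ring)).
by clear - H; lra.
Qed.

End TopBoundMain.

(** * The lower tail *)

Lemma admissible_transpose {R : realType} m n (g zeta c C1 eps : R) :
  admissible m n g zeta c C1 eps -> admissible n m g (1 - zeta) c C1 eps.
Proof.
move=> [[g0 mE nE] [c0 c4 C1c czeta zetac] [e0 ec ge1]].
split; split => //; [|lra|lra].
by rewrite mE; congr (_ * _ ^+ 2); ring.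
Qed.

Section BulkLowerTail.
Context {d : measure_display} {T : measurableType d} {R : realType}.
Local Notation Exp a := (exponential_prob (a : R)).
Variables (P : probability T R) (X : site -> T -> R).
Hypothesis indX : indep_law P X (fun=> Exp 1).
Hypothesis X0 : forall p t, 0 <= X p t.
Let x t : site -> R := fun p => X p t.

Lemma transpose_inj : injective transpose.
Proof. by move=> [a b] [a' b'] [-> ->]. Qed.

Lemma bulk_transpose (y : site -> R) i j :
  lastpass (bulk (fun p => y (transpose p))) j i = lastpass (bulk y) i j.
Proof.
rewrite -(lastpass_transpose (bulk y)); apply: eq_lastpass => a b _ _.
rewrite /bulk /no_bottom /no_left /transpose /=.
by case: (a == 0%N); case: (b == 0%N).
Qed.

(** With boundaries of rates zeta - eps and 1 - zeta - eps the lower tail follows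
    from the moment identity, the slope being at least g. The optimal path of that
    model leaves the bulk through the north or the east side, and both cases are
    covered by [top_exit_bound], up to a transposition. *)
Lemma lastpass_bulk_lower_tail m n (g zeta c C1 eps : R) :
  (0 < m)%N -> (0 < n)%N -> admissible m n g zeta c C1 eps ->
  exists2 B : set T, unlikely P (13 * expR (- (c * (g * eps ^+ 3)))) B &
  forall t, ~ B t ->
    g - (C1 + 1 + 720 * C1 / c ^+ 2) * (g * eps ^+ 2) < lastpass (bulk (x t)) m n.
Proof.
move=> m0 n0 adm; have [[g0 mE nE] [c0 c4 C1c czeta zetac] [e0 ec ge1]] := adm.
have q0 : 0 < g * eps ^+ 3 by rewrite mulr_gt0// exprn_gt0.
have C18 : 8 <= C1 by rewrite -(ler_pM2r c0) C1c; lra.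
have [B1 U1 top] := top_exit_bound indX X0 adm.
have indXt := indep_law_reindex transpose_inj indX.
have X0t p t : 0 <= X (transpose p) t by exact: X0.
have [B2 U2 right_] := top_exit_bound indXt X0t (admissible_transpose adm).
pose b := g - C1 * (g * eps ^+ 2).
pose B3 := [set t | lastpass (ne_field m n (zeta - eps) (zeta + eps) (x t)) m.+1 n.+1 <= b].
have w0 : 0 < zeta - eps by lra.
have wz : zeta - eps < zeta + eps by lra.
have z1 : zeta + eps < 1 by lra.
have U3 : unlikely P (expR (- (c * (g * eps ^+ 3)))) B3.
  split; first exact/measurable_sublevel/(measurable_lastpass_ne indX).
  apply: le_trans (ne_lower_tail indX X0 _ m n w0 wz z1) _.
  rewrite lee_fin ler_expR.
  have H : (zeta + eps - (zeta - eps)) * g <=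
      potential m n (zeta + eps) - potential m n (zeta - eps).
    apply: potential_ge => // u /andP[wu uz].
    have u01 : 0 < u < 1 by apply/andP; split; lra.
    apply: le_trans (slope_ge (ltW g0) mE nE u01).
    by rewrite ler_peMr ?(ltW g0)// lerDl mulr_ge0 ?sqr_ge0.
  have E : (zeta + eps - (zeta - eps)) * b =
     (zeta + eps - (zeta - eps)) * g - 2 * C1 * (g * eps ^+ 3) by rewrite /b; ring.
  rewrite E.
  have : c * (g * eps ^+ 3) <= 2 * C1 * (g * eps ^+ 3).
    by rewrite ler_wpM2r ?(ltW q0)//; lra.
  lra.
have U := unlikelyU (unlikelyU U1 U2) U3.
eexists; first apply: unlikelyW U; first lra.
move=> t /= nB.
have n1 : ~ B1 t by move=> h; apply: nB; left; left.
have n2 : ~ B2 t by move=> h; apply: nB; left; right.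
have n3 : b < lastpass (ne_field m n (zeta - eps) (zeta + eps) (x t)) m.+1 n.+1.
  by rewrite ltNge; apply/negP => h; apply: nB; right.
have xt0 p : 0 <= x t p by exact: X0.
have ge0 : 0 <= g * eps ^+ 2 by rewrite mulr_ge0 ?sqr_ge0 ?ltW.
have conclude A : b < A -> A <= Num.max (lastpass (bulk (x t)) m n +
    (1 + 720 * C1 / c ^+ 2) * (g * eps ^+ 2)) (g - C1 * (g * eps ^+ 2)) ->
    g - (C1 + 1 + 720 * C1 / c ^+ 2) * (g * eps ^+ 2) < lastpass (bulk (x t)) m n.
  move=> bA; rewrite le_max -/b => /orP[h|h].
    have := lt_le_trans bA h; rewrite /b; lra.
  by have := lt_le_trans bA h; rewrite ltxx.
have [[k km le]|[k km le]] := ne_exit w0 z1 xt0 m0 n0.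
  exact: (conclude _ (lt_le_trans n3 le) (top t n1 k km)).
apply: (conclude _ (lt_le_trans n3 le)).
have := right_ t n2 k km; rewrite /= !(bulk_transpose (x t)).
by have -> : 1 - zeta - eps = 1 - (zeta + eps) by ring.
Qed.

End BulkLowerTail.

Section LptLastpass.
Context {R : realType}.
Implicit Types (w : site -> R).

Definition shift1 (p : site) : site := (p.1.+1, p.2.+1).

Lemma up_right_path_uniq (u : site) s : path up_right_step u s -> uniq (u :: s).
Proof.
move=> us; pose r (p q : site) := (p.1 + p.2 < q.1 + q.2)%N.
have rtr : transitive r by move=> p q v; exact: ltn_trans.
apply: (sorted_uniq rtr) => [p|]; first by rewrite /r ltnn.
apply: sub_path us => p q /orP[]/eqP ->; rewrite /r /=; first by rewrite addSn.
by rewrite addnS.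
Qed.

Lemma sum_path_fset w (u : site) s : path up_right_step u s ->
  \sum_(p <- enum_fset [fset p in u :: s]%fset) w p = \sum_(p <- u :: s) w p.
Proof.
move=> /up_right_path_uniq us; apply: perm_big; apply: uniq_perm => //.
by move=> p; rewrite in_fset.
Qed.

Lemma path_weight_shift w (u v : site) s : (0 < u.1)%N -> (0 < u.2)%N ->
  path up_right_step u s -> last u s = v ->
  \sum_(p <- s) w p + lastpass (fun p => w (shift1 p)) u.1.-1 u.2.-1 <=
  lastpass (fun p => w (shift1 p)) v.1.-1 v.2.-1.
Proof.
move=> u1 u2; elim: s u u1 u2 => [|a s IH] u u1 u2 /=.
  by move=> _ <-; rewrite big_nil add0r.
move=> /andP[/orP ua sp] sv.
have [a1 a2] : (0 < a.1)%N /\ (0 < a.2)%N by case: ua => /eqP ->.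
apply: le_trans (IH a a1 a2 sp sv); rewrite big_cons (addrC (w a)) -addrA lerD2l.
case: u u1 u2 ua => [[|i] [|j]] //= _ _ [] /eqP -> /=.
  exact: (lastpass_stepl (fun p => w (shift1 p))).
exact: (lastpass_stepr (fun p => w (shift1 p))).
Qed.

(** Supremum over vertex sets of paths and recursion agree, whatever the signs of
    the weights; in particular the former is measurable in the weights. *)
Lemma lpt_lastpass w i j :
  lpt w (1, 1)%N (i.+1, j.+1) = lastpass (fun p => w (shift1 p)) i j.
Proof.
apply/le_anti/andP; split.
  have [//|//|_ [s /= [sp sv] <-] ->] := lpt_attained w (u := (1, 1)%N) (v := (i.+1, j.+1)).
  rewrite sum_path_fset// big_cons addrC.
  by have := path_weight_shift w (u := (1, 1)%N) isT isT sp sv; rewrite /= lpE.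
have [s [sp sl <-]] := path_attained (fun p => w (shift1 p)) i j.
have sp' : path up_right_step (1, 1)%N (map shift1 s).
  rewrite -[(1, 1)%N]/(shift1 (0, 0)%N) path_map.
  by apply: sub_path sp => p q; rewrite /up_right_step /shift1 => /orP[]/eqP ->;
    rewrite /= eqxx ?orbT.
have := @lpt_ub R w (1, 1)%N (i.+1, j.+1) [fset p in (1, 1)%N :: map shift1 s]%fset.
rewrite sum_path_fset// big_cons big_map big_cons; apply.
exists (map shift1 s) => //; split=> //.
by rewrite -[(1, 1)%N]/(shift1 (0, 0)%N) last_map sl.
Qed.

Lemma lastpass_bulk w i j : (forall p, 0 <= w p) ->
  lastpass (bulk w) i.+1 j.+1 = lastpass (fun p => w (shift1 p)) i j.
Proof.
move=> w0; have z1 a : lastpass (bulk w) a 0 = 0.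
  by elim: a => [|a IH]; rewrite lpE ?IH ?addr0 /bulk /no_bottom.
have z2 b : lastpass (bulk w) 0 b = 0.
  have b0 k : bulk w (0, k)%N = 0.
    by rewrite /bulk /no_bottom /no_left /=; case: (k == 0)%N.
  by elim: b => [|b IH]; rewrite lpE b0 ?IH ?addr0.
have nn p : 0 <= w (shift1 p) by exact: w0.
move: i j; apply: grid_ind => [|i IH|j IH|i j IH1 IH2].
- by rewrite lastpassSS z1 z2 maxxx addr0 lastpass00.
- rewrite lastpassSS z1 IH [RHS]lpE max_l//; exact: lastpass_ge0.
- rewrite lastpassSS z2 IH [RHS]lpE max_r//; exact: lastpass_ge0.
- by rewrite lastpassSS IH1 IH2 [RHS]lpE.
Qed.

End LptLastpass.

(** * From the field of the statement to the models *)

Section FromIid.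
Context {d : measure_display} {T : measurableType d} {R : realType}.
Local Notation Exp a := (exponential_prob (a : R)).
Variable P : probability T R.

Lemma iid_exp1_indep_law (omega : site -> {RV P >-> R}) (phi : site -> site) :
  iid_exp1 omega -> injective phi -> (forall p, pos_quadrant (phi p)) ->
  indep_law P (fun p t => omega (phi p) t) (fun=> Exp 1).
Proof.
move=> [ind law] phiI phi0; split=> [p|s A us mA]; first exact: measurable_funPT.
pose J := [fset q in map phi s]%fset.
pose B q := \bigcap_(p in [set p | p \in s /\ phi p = q]) A p.
have BE p : p \in s -> B (phi p) = A p.
  move=> ps; apply/seteqP; split => y; first by move=> /(_ p); apply.
  by move=> Ay p' [ps' /phiI ->].
have mB q : measurable (B q).
  have [[p [ps <-]]|nq] := pselect (exists p, p \in s /\ phi p = q).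
    by rewrite BE.
  rewrite (_ : B q = setT)//; apply/seteqP; split => // y _ p [ps pq].
  by case: nq; exists p.
have JD : [set` J] `<=` pos_quadrant.
  by move=> q /=; rewrite in_fset => /mapP[p _ ->].
have E := ind J JD B mB.
transitivity (P (\bigcap_(q in [set` J]) (omega q @^-1` B q))).
  congr (P _); apply/seteqP; split => t /= H q.
    rewrite /= in_fset => /mapP[p ps ->] /=; rewrite BE//; exact: H.
  move=> qs; rewrite -(BE q qs); apply: (H (phi q)).
  by rewrite /= in_fset map_f.
rewrite E (perm_big (map phi s)); last first.
  have um : uniq (map phi s) by rewrite map_inj_uniq.
  by apply: uniq_perm; [exact: fset_uniq|exact: um|move=> q; rewrite in_fset].
rewrite big_map; apply: eq_big_seq => p ps; rewrite BE//.
exact: law.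
Qed.

(** Exponential variables are almost surely nonnegative, so that the field may be
    replaced by its positive part. *)
Lemma exponential_prob_pos (A : set R) : measurable A ->
  Exp 1 [set x | A (Num.max x 0)] = Exp 1 A.
Proof.
move=> mA; pose e1 : probability (measurableTypeR R) R := exponential_prob 1.
pose f (x : measurableTypeR R) : R := Num.max (x : R) 0.
pose i (x : measurableTypeR R) : R := x.
have mi : measurable_fun setT i by move=> _ B mB; rewrite setTI.
have mf : measurable_fun setT f by exact: measurable_maxr.
pose m1 : {measure set R -> \bar R} := pushforward (e1 ltr01) f.
pose m2 : {measure set R -> \bar R} := pushforward (e1 ltr01) i.
rewrite -[LHS]/(m1 mf A) -[RHS]/(m2 mi A).
apply: eq_measure_half_lines; [|move=> r|exact: mA].
  rewrite -[m1 mf setT]/(Exp 1 setT) /exponential_prob integral_exponential_pdf//.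
  by rewrite ltry.
rewrite -[LHS]/(Exp 1 [set x | (`]r, +oo[%classic : set R) (Num.max x 0)]).
rewrite -[RHS]/(Exp 1 `]r, +oo[%classic) Exp_half_line//.
have [r0|r0] := ltP r 0.
  rewrite (_ : [set x | _] = setT); last first.
    apply/seteqP; split => x //= _; rewrite in_itv /= andbT.
    by apply: lt_le_trans r0 _; rewrite le_max lexx orbT.
  by rewrite mulr0 expR0 /exponential_prob integral_exponential_pdf.
rewrite (_ : [set x | _] = `]r, +oo[%classic); last first.
  by apply/seteqP; split => x /=; rewrite !in_itv /= !andbT lt_max (ltNge r 0) r0 orbF.
by rewrite Exp_half_line// max_l.
Qed.

(** The bulk stays in place and the sites around it, where boundary weights are
    read, are sent to other sites of the quadrant. All auxiliary randomness is
    thus part of the given field. *)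
Definition spread (m n : nat) (p : site) : site :=
  if [&& 0 < p.1, p.1 <= m, 0 < p.2 & p.2 <= n]%N then p
  else ((p.1 + m).+1, (p.2 + n).+1).

Lemma spread_inj m n : injective (spread m n).
Proof.
move=> [a b] [a' b']; rewrite /spread /=.
case: ifP => [/and4P[a0 am b0 bn]|_]; case: ifP => [/and4P[a0' am' b0' bn']|_] // [] E1 E2.
- by exfalso; move: am; rewrite E1 -ltnS ltnS ltnNge leq_addl.
- by exfalso; move: am'; rewrite -E1 -ltnS ltnS ltnNge leq_addl.
- by congr pair; [apply: (@addIn m)|apply: (@addIn n)].
Qed.

Lemma spread_pos m n p : pos_quadrant (spread m n p).
Proof. by rewrite /spread; case: ifP => [/and4P[]|]. Qed.

Lemma negative_unlikely (X : site -> T -> R) (s : seq site) :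
  indep_law P X (fun=> Exp 1) ->
  unlikely P 0 [set t | exists2 p, p \in s & X p t < 0].
Proof.
move=> indX; elim: s => [|a s IH].
  rewrite (_ : [set t | _] = set0); first exact: unlikely0.
  by apply/seteqP; split => t // [].
have U : unlikely P 0 [set t | X a t < 0].
  have mI : measurable (`]-oo, (0 : R)[%classic : set R) by [].
  have E := indep_law_marginal a indX mI.
  rewrite (_ : [set t | _] = X a @^-1` `]-oo, 0[%classic); last first.
    by apply/seteqP; split => t /=; rewrite in_itv.
  split; first exact: measurable_preimageT (indX.1 a) mI.
  rewrite E /exponential_prob integral0_eq// => y /=.
  by rewrite in_itv /= => y0; rewrite lt0_exponential_pdf.
have := unlikelyU U IH; rewrite addr0.
rewrite (_ : [set t | exists2 p, p \in a :: s & X p t < 0] =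
  [set t | X a t < 0] `|` [set t | exists2 p, p \in s & X p t < 0])//.
apply/seteqP; split => t /=.
  move=> [p]; rewrite inE => /orP[/eqP->|ps] Xp; first by left.
  by right; exists p.
move=> [Xa|[p ps Xp]]; first by exists a; rewrite ?mem_head.
by exists p; rewrite // inE ps orbT.
Qed.

Lemma measurable_lpt (omega : site -> {RV P >-> R}) m n :
  measurable_fun setT (fun t => lpt (fun p => omega p t) (1, 1)%N (m.+1, n.+1)).
Proof.
rewrite (_ : (fun t => _) = (fun t => lastpass (fun p => omega (shift1 p) t) m n)).
  apply: (@measurable_lastpass _ _ _ (fun p t => omega (shift1 p) t)) => p.
  exact: measurable_funPT.
by apply/funext => t; rewrite lpt_lastpass.
Qed.

(** The estimate in terms of the free parameter eps: a deficit of order g eps^2 has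
    probability at most of order exp (- c g eps^3). *)
Lemma lpt_lower_tail (omega : site -> {RV P >-> R}) m n (g zeta c C1 eps b : R) :
  iid_exp1 omega -> admissible m.+1 n.+1 g zeta c C1 eps ->
  b <= g - (C1 + 1 + 720 * C1 / c ^+ 2) * (g * eps ^+ 2) ->
  (P [set t | (lpt (fun p => omega p t) (1, 1)%N (m.+1, n.+1) <= b)%R] <=
   (13 * expR (- (c * (g * eps ^+ 3))))%R%:E)%E.
Proof.
move=> iid adm bb.
have indW := iid_exp1_indep_law iid (@spread_inj m.+1 n.+1) (spread_pos m.+1 n.+1).
pose X p t : R := Num.max (omega (spread m.+1 n.+1 p) t) 0.
have mmax : forall p : site, measurable_fun setT (fun x : R => Num.max x 0).
  by move=> _; exact: measurable_maxr.
have indX : indep_law P X (fun=> Exp 1).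
  apply: indep_law_eq (indep_law_comp mmax indW) => k A mA.
  exact: exponential_prob_pos.
have X0 p t : 0 <= X p t by rewrite /X le_max lexx orbT.
have [B U HB] := lastpass_bulk_lower_tail indX X0 (ltn0Sn m) (ltn0Sn n) adm.
pose s : seq site := [seq (i, j) | i <- iota 1 m.+1, j <- iota 1 n.+1].
have U' := unlikelyU U (negative_unlikely s indW).
rewrite addr0 in U'.
apply: le_trans U'.2; apply: le_measure; rewrite ?inE.
- exact: (measurable_sublevel _ (measurable_lpt omega m n)).
- exact: U'.1.
move=> t /= tb; apply: contrapT => /not_orP[nB nneg].
have := HB t nB; apply/negP; rewrite -leNgt; apply: le_trans bb; apply: le_trans tb.
rewrite lastpass_bulk// lpt_lastpass; apply: ler_lastpass => i j im jn.
have sij : spread m.+1 n.+1 (shift1 (i, j)) = shift1 (i, j).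
  by rewrite /spread /= !ltnS im jn.
rewrite /X sij ge_max lexx /= leNgt; apply/negP => neg; apply: nneg.
exists (shift1 (i, j)); last by rewrite sij.
by apply/allpairsP; exists (shift1 (i, j)); split=> //; rewrite mem_iota add1n !ltnS /=.
Qed.

End FromIid.

Section Negative.
Context {d : measure_display} {T : measurableType d} {R : realType}.
Variable P : probability T R.

Lemma lpt_negative (omega : site -> {RV P >-> R}) m n (b : R) :
  iid_exp1 omega -> b < 0 ->
  (P [set t | (lpt (fun p => omega p t) (1, 1)%N (m.+1, n.+1) <= b)%R] <= 0)%E.
Proof.
move=> iid b0.
have indW := iid_exp1_indep_law iid (@spread_inj m.+1 n.+1) (spread_pos m.+1 n.+1).
pose s : seq site := [seq (i, j) | i <- iota 1 m.+1, j <- iota 1 n.+1].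
have [mN PN] := negative_unlikely s indW.
apply: le_trans PN; apply: le_measure; rewrite ?inE//.
  exact: (measurable_sublevel _ (measurable_lpt omega m n)).
move=> t /= tb; apply: contrapT => nneg.
have : lastpass (fun p => 0) m n <= lpt (fun p => omega p t) (1, 1)%N (m.+1, n.+1).
  rewrite lpt_lastpass; apply: ler_lastpass => i j im jn.
  have sij : spread m.+1 n.+1 (shift1 (i, j)) = shift1 (i, j).
    by rewrite /spread /= !ltnS im jn.
  rewrite leNgt; apply/negP => neg; apply: nneg.
  exists (shift1 (i, j)); last by rewrite sij.
  by apply/allpairsP; exists (shift1 (i, j)); split=> //; rewrite mem_iota add1n !ltnS /=.
have : 0 <= lastpass (fun p : site => 0 : R) m n by exact: lastpass_ge0.
lra.
Qed.

End Negative.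

Lemma cone_direction {R : realType} (delta a b : R) : 0 < delta -> 0 < a -> 0 < b ->
  delta * b <= a ->
  2 * (Num.sqrt delta / (4 * (1 + Num.sqrt delta))) <=
  Num.sqrt a / (Num.sqrt a + Num.sqrt b).
Proof.
move=> d0 a0 b0 dba; set D := Num.sqrt delta.
have D0 : 0 < D by rewrite sqrtr_gt0.
have sa0 : 0 < Num.sqrt a by rewrite sqrtr_gt0.
have sb0 : 0 < Num.sqrt b by rewrite sqrtr_gt0.
have H : D * Num.sqrt b <= Num.sqrt a.
  rewrite -sqrtrM; last exact: ltW.
  exact: ler_wsqrtr.
rewrite ler_pdivlMr ?addr_gt0//.
have -> : 2 * (D / (4 * (1 + D))) * (Num.sqrt a + Num.sqrt b) =
  (D * (Num.sqrt a + Num.sqrt b)) / (2 * (1 + D)).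
  by field; rewrite gt_eqF// addr_gt0.
rewrite ler_pdivrMr ?mulr_gt0 ?addr_gt0//.
have : 0 <= D * Num.sqrt a by rewrite mulr_ge0// ltW.
nra.
Qed.

Lemma powR_third_cube {R : realType} (x : R) : 0 <= x -> (x `^ (1 / 3)) ^+ 3 = x.
Proof.
move=> x0; rewrite -powR_mulrn ?powR_ge0// -powRrM.
by rewrite (_ : 1 / 3 * 3%:R = 1 :> R) ?powRr1//; field.
Qed.

Lemma powR_three_halves {R : realType} (x : R) : 0 <= x -> x `^ (3 / 2) = Num.sqrt x ^+ 3.
Proof.
move=> x0; rewrite -powR12_sqrt// -powR_mulrn ?powR_ge0// -powRrM.
by congr (_ `^ _); field.
Qed.

Theorem theorem2p3 (R : realType) (delta : R) (delta_gt0 : 0 < delta) :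
  exists (c0 : R) (N0 : nat) (s0 : R),
    [/\ 0 < c0, (0 < N0)%N & 0 < s0] /\
    forall (d : measure_display) (T : measurableType d) (P : probability T R)
      (omega : site -> {RV P >-> R}),
      iid_exp1 omega ->
      forall (v : site) (s : R),
        cone delta (site_point R v) -> quadrant_from N0 v -> s0 <= s ->
        (P [set t | (lpt (fun p => omega p t) (1, 1)%N v <=
                     lpp_shape (site_point R v)
                     - s * l1norm (site_point R v) `^ (1 / 3))%R]
         <= (expR (- (c0 * s `^ (3 / 2))))%:E)%E.
Proof.
pose D := Num.sqrt delta.
have D0 : 0 < D by rewrite sqrtr_gt0.
(* twice c bounds zeta and 1 - zeta from below over the cone *)
pose c := D / (4 * (1 + D)).
have c0 : 0 < c by rewrite divr_gt0// mulr_gt0// addr_gt0.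
have c4 : 4 * c <= 1.
  have -> : 4 * c = D / (1 + D) by rewrite /c; field; rewrite gt_eqF// addr_gt0.
  by rewrite ler_pdivrMr ?addr_gt0// mul1r; lra.
pose C1 := 2 / c.
have C1c : C1 * c = 2 by rewrite /C1 divfK// gt_eqF.
have C18 : 8 <= C1 by rewrite -(ler_pM2r c0) C1c; lra.
pose C := C1 + 1 + 720 * C1 / c ^+ 2.
have C1C : C1 + 1 <= C.
  have c2 : 0 <= (c ^+ 2)^-1 by rewrite invr_ge0 sqr_ge0.
  have : 0 <= 720 * C1 * (c ^+ 2)^-1 by apply: mulr_ge0; [lra|exact: c2].
  rewrite /C; lra.
have C0 : 0 < C by lra.
(* eps is kappa * sqrt s * (m + n)^(-1/3): the deficit of order g eps^2 is then
   at most s (m + n)^(1/3), as g <= 2 (m + n) *)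
pose kappa := (8 * C)^-1.
have k0 : 0 < kappa by rewrite invr_gt0 mulr_gt0.
have kC : 8 * (kappa * C) = 1.
  by rewrite /kappa; field; rewrite gt_eqF.
have k8c : 8 * kappa <= c.
  have H : C1 * c <= C * c by rewrite ler_pM2r//; lra.
  rewrite -(ler_pM2r C0); lra.
have k1 : kappa <= 1 by lra.
pose c1 := c * kappa ^+ 3 / 2.
have c10 : 0 < c1 by rewrite divr_gt0// mulr_gt0// exprn_gt0.
pose s0 := (kappa ^+ 2)^-1 + 13 / c1 + 1.
have a0 : 0 < (kappa ^+ 2)^-1 by rewrite invr_gt0 exprn_gt0.
have b0 : 0 < 13 / c1 by rewrite divr_gt0.
exists c1, 1%N, s0; split; first by split=> //; rewrite /s0; lra.
move=> d T P omega iid [[|m] [|n]] s; rewrite /cone /quadrant_from /site_point /=.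
- by move=> _ [].
- by move=> _ [].
- by move=> _ [].
move=> [m0 n0 dnm dmn] _ ss0.
rewrite /lpp_shape /l1norm /= !ger0_norm//.
set a := m.+1%:R; set b := n.+1%:R.
have N0 : 0 <= a + b :> R by rewrite addr_ge0.
set r := (a + b) `^ (1 / 3).
have r3 : r ^+ 3 = a + b by exact: powR_third_cube.
have s00 : 0 <= s by rewrite /s0 in ss0; lra.
rewrite powR_three_halves//; set sg := Num.sqrt s.
have sg2 : sg ^+ 2 = s by rewrite sqr_sqrtr.
have a1 : 1 <= a :> R by rewrite ler1n.
have b1 : 1 <= b :> R by rewrite ler1n.
have r0 : 0 <= r by exact: powR_ge0.
have r1 : 1 <= r.
  by rewrite -(@ler_pXn2r _ 3) ?nnegrE// expr1n r3; lra.
set sa := Num.sqrt a; set sb := Num.sqrt b.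
have sa2 : sa ^+ 2 = a by rewrite sqr_sqrtr// ltW.
have sb2 : sb ^+ 2 = b by rewrite sqr_sqrtr// ltW.
have sa0 : 0 < sa by rewrite sqrtr_gt0.
have sb0 : 0 < sb by rewrite sqrtr_gt0.
pose g := (sa + sb) ^+ 2.
have gN : a + b <= g.
  have : 0 <= sa * sb by rewrite mulr_ge0// ltW.
  rewrite /g sqrrD sa2 sb2; lra.
have g2N : g <= 2 * (a + b).
  have := sqr_ge0 (sa - sb); rewrite sqrrB sa2 sb2 => h.
  rewrite /g sqrrD sa2 sb2; lra.
have sg0 : 0 <= sg by exact: sqrtr_ge0.
have sgk : 1 <= kappa * sg.
  rewrite -(@ler_pXn2r _ 2) ?nnegrE ?mulr_ge0 ?(ltW k0)// expr1n exprMn sg2.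
  have -> : 1 = kappa ^+ 2 * (kappa ^+ 2)^-1 by rewrite mulfV// gt_eqF// exprn_gt0.
  by rewrite ler_wpM2l ?sqr_ge0//; rewrite /s0 in ss0; lra.
have sg1 : 1 <= sg.
  by apply: le_trans sgk _; rewrite ler_piMl.
(* beyond s = 2 (m + n)^(2/3) the level is negative; below it eps is small *)
have [big|small] := ltP (2 * r ^+ 2) s.
  apply: (@le_trans _ _ 0%E); last by rewrite lee_fin expR_ge0.
  apply: lpt_negative => //.
  have : 2 * r ^+ 2 * r < s * r by rewrite ltr_pM2r//; lra.
  have -> : 2 * r ^+ 2 * r = 2 * (a + b) by rewrite -r3; ring.
  rewrite -/g; lra.
have sgr : sg <= 2 * r.
  rewrite -(@ler_pXn2r _ 2) ?nnegrE ?mulr_ge0// sg2 exprMn.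
  apply: le_trans small _; rewrite ler_wpM2r ?sqr_ge0//; lra.
pose zeta := sa / (sa + sb).
have sab : 0 < sa + sb by rewrite addr_gt0.
pose eps := kappa * sg / r.
have rp : 0 < r by lra.
have e0 : 0 < eps by rewrite divr_gt0// mulr_gt0//; lra.
have er : eps * r = kappa * sg by rewrite /eps divfK// gt_eqF.
have adm : admissible m.+1 n.+1 g zeta c C1 eps.
  split; split => //.
  - by rewrite /g exprn_gt0.
  - by rewrite /g /zeta -/a -sa2; field; rewrite gt_eqF.
  - by rewrite /g /zeta -/b -sb2; field; rewrite gt_eqF.
  - exact: cone_direction.
  - have : 2 * c <= sb / (sb + sa) by exact: cone_direction.
    have -> : sb / (sb + sa) = 1 - zeta.
      by rewrite /zeta; field; rewrite !gt_eqF// addr_gt0.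
    lra.
  - rewrite -(ler_pM2r rp) -mulrA er.
    apply: (@le_trans _ _ (8 * kappa * r)); last by rewrite ler_pM2r.
    have : kappa * sg <= kappa * (2 * r) by rewrite ler_pM2l.
    lra.
  - rewrite -(ler_pM2r rp) -mulrA er mul1r.
    have h : r ^+ 3 * 1 <= g * (kappa * sg) by apply: ler_pM => //; rewrite ?exprn_ge0// r3.
    apply: le_trans h; rewrite mulr1 -[leLHS]expr1 ler_weXn2l//.
have thr : (sa + sb) ^+ 2 - s * r <= g - C * (g * eps ^+ 2).
  rewrite lerD2l lerN2.
  have E1 : eps ^+ 2 * r ^+ 2 = kappa ^+ 2 * s by rewrite -exprMn er exprMn sg2.
  have r20 : 0 < r ^+ 2 by exact: exprn_gt0.
  rewrite -(ler_pM2r r20).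
  have -> : C * (g * eps ^+ 2) * r ^+ 2 = C * (kappa ^+ 2 * s) * g by rewrite -E1; ring.
  have -> : C * (kappa ^+ 2 * s) * g = (8 * (kappa * C)) * (kappa * s / 8) * g by field.
  rewrite kC mul1r.
  have -> : s * r * r ^+ 2 = s / 8 * (8 * (a + b)) by rewrite -r3; field.
  apply: ler_pM; [by rewrite divr_ge0// mulr_ge0// ltW|lra| |lra].
  by rewrite ler_pM2r ?invr_gt0// ler_piMl.
apply: le_trans (lpt_lower_tail iid adm thr) _.
rewrite lee_fin.
have ge3 : kappa ^+ 3 * sg ^+ 3 <= g * eps ^+ 3.
  rewrite -exprMn -er exprMn mulrC r3.
  by apply: ler_wpM2r => //; rewrite exprn_ge0// ltW.
apply: (@le_trans _ _ (13 * expR (- (2 * (c1 * sg ^+ 3))))).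
  rewrite ler_pM2l// ler_expR lerN2.
  have -> : 2 * (c1 * sg ^+ 3) = c * (kappa ^+ 3 * sg ^+ 3) by rewrite /c1; field.
  by rewrite ler_pM2l.
have -> : - (2 * (c1 * sg ^+ 3)) = - (c1 * sg ^+ 3) + - (c1 * sg ^+ 3) by ring.
(* half of the exponent absorbs the factor 13, for s at least s0 *)
rewrite expRD mulrA ler_piMl ?expR_ge0// expRN ler_pdivrMr ?expR_gt0// mul1r.
apply: le_trans (expR_ge1Dx _).
have : 13 <= c1 * sg ^+ 3; last lra.
apply: (@le_trans _ _ (c1 * s)).
  have : 13 / c1 <= s by rewrite /s0 in ss0; lra.
  by rewrite ler_pdivrMr// mulrC.
by rewrite ler_pM2l// -sg2 ler_weXn2l.
Qed.
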